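(* Let $\xi$ be a transcendental real number and $n\ge2$ an integer. Then \[ \omega_n^*(\xi)\ge F_n:=\inf_{x\ge n}F(x). \]
   Context: $H(\alpha)$ is the naive height of an algebraic number $\alpha$ (max absolute value of coefficients of its minimal polynomial over $\mathbb{Z}$); $\omega_n^*(\xi)$ is the supremum of $\omega^*>0$ such that infinitely many algebraic $\alpha$ of degree at most $n$ satisfy $0<|\xi-\alpha|\le H(\alpha)^{-\omega^*-1}$. For real $x\ge n$ let $\mathcal{A}(x)=\{\mathbf{a}=(a_2,\dots,a_{n+1})\in\mathbb{R}^n:\ 1=a_2\le\cdots\le a_{n+1},\ a_2+\cdots+a_{n+1}=x\}$. For $\mathbf{a}\in\mathcal{A}(x)$ and $2\le k\le n+1$ let $A_k(x,\mathbf{a})=2x-2(n-k+1)-\sum_{i=2}^k a_i$, let $F(x,\mathbf{a})=\max_{2\le k\le n+1}A_k(x,\mathbf{a})/a_k$, and let $F(x)=\min_{\mathbf{a}\in\mathcal{A}(x)}F(x,\mathbf{a})$. *)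

(* Defs.v *)
From HB Require Import structures.
From mathcomp Require Import all_boot all_order all_algebra.
From mathcomp Require Import complex lra.
From mathcomp Require Import all_classical all_reals all_analysis.

Set Implicit Arguments.
Unset Strict Implicit.
Unset Printing Implicit Defensive.

Import Order.TTheory GRing.Theory Num.Theory.
Import numFieldNormedType.Exports.

Local Open Scope classical_set_scope.
Local Open Scope complex_scope.
Local Open Scope ring_scope.

(* [zcontents P] is the gcd of the coefficients of [P] with the sign of its
   leading coefficient, so [zcontents P = 1] says that [P] is primitive with
   positive leading coefficient; together with irreducibility over the
   rationals this determines [P] from [alpha]. *)
Definition is_minpolyZ (R : realType) (alpha : R[i]) (P : {poly int}) : Prop :=
  [/\ zcontents P = 1,
      irreducible_poly (map_poly intr P : {poly rat}) &
      root (map_poly intr P) alpha].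

Definition naive_height (P : {poly int}) : nat :=
  (\max_(i < size P) `|(P`_i)%R|)%N.

(* The algebraic numbers [alpha] are complex; the existence of an integral
   minimal polynomial [P] expresses that [alpha] is algebraic. The comparison
   is made in [R[i]], where [`|_|] takes its (real) values. *)
Definition approximants (R : realType) (n : nat) (xi w : R) : set R[i] :=
  [set alpha | exists P : {poly int},
    [/\ is_minpolyZ alpha P,
        (size P <= n.+1)%N,
        0 < `|xi%:C - alpha| &
        `|xi%:C - alpha| <= ((naive_height P)%:R `^ (- w - 1))%:C]].

Definition omega_star (R : realType) (n : nat) (xi : R) : \bar R :=
  ereal_sup [set w%:E | w in
    [set w : R | 0 < w /\ infinite_set (approximants n xi w)]].

(* The vector (a_2, ..., a_(n+1)) is a row vector [a] whose entry [a 0 i],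
   i = 0, ..., n - 1, is a_k for k = i + 2. *)
Definition calA (R : realType) (n : nat) (x : R) : set 'rV[R]_n :=
  [set a : 'rV[R]_n |
    [/\ forall i : 'I_n, i = 0%N :> nat -> a 0 i = 1,
        forall i j : 'I_n, (i <= j)%N -> a 0 i <= a 0 j &
        \sum_(i < n) a 0 i = x]].

(* A_k(x, a) for k = i + 2; the subtraction on [nat] is exact since k <= n + 1. *)
Definition A_ (R : realType) (n : nat) (x : R) (a : 'rV[R]_n) (i : 'I_n) : R :=
  2 * x - 2 * (n.+1 - i.+2)%:R - \sum_(j < n | (j <= i)%N) a 0 j.

Definition F_vec (R : realType) (n : nat) (x : R) (a : 'rV[R]_n) : \bar R :=
  \big[maxe/-oo%E]_(i < n) (A_ x a i / a 0 i)%:E.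

(* This infimum is a minimum, see [F_at_min] below. *)
Definition F_at (R : realType) (n : nat) (x : R) : \bar R :=
  ereal_inf [set F_vec x a | a in @calA R n x].

Definition F_inf (R : realType) (n : nat) : \bar R :=
  ereal_inf [set F_at n x | x in [set x : R | n%:R <= x]].

Lemma calA_ge1 (R : realType) (n : nat) (x : R) (a : 'rV[R]_n) (i : 'I_n) :
  calA x a -> 1 <= a 0 i.
Proof.
case: n => [|n] in a i *; first by case: i.
by move=> [a0 aS _]; rewrite -(a0 ord0)//; exact: aS.
Qed.

Lemma calA_nonempty (R : realType) (n : nat) (x : R) :
  (1 < n)%N -> n%:R <= x -> @calA R n x !=set0.
Proof.
case: n => [//|[//|n]] _ nx.
exists (\row_(i < n.+2) if i == ord_max then x - n.+1%:R else 1).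
split => [i i0|i j ij|].
- by rewrite mxE; case: eqP => // ie; move: i0; rewrite ie.
- rewrite !mxE; case: (i =P ord_max) => [ie|_].
    suff -> : j == ord_max by [].
    rewrite -val_eqE eqn_leq -ltnS ltn_ord /=.
    by rewrite -[X in (X <= _)%N]/(val (@ord_max n.+1)) -ie.
  by case: eqP => // _; rewrite lerBrDr -natr1 addrC in nx *.
- rewrite big_ord_recr/= mxE eqxx (eq_bigr (fun=> 1)).
    by rewrite sumr_const card_ord addrC subrK.
  by move=> i _; rewrite mxE -val_eqE/= ltn_eqF.
Qed.

Lemma calA_compact (R : realType) (n : nat) (x : R) : compact (@calA R n x).
Proof.
apply: bounded_closed_compact.
- exists `|x|; split; first exact: num_real.
  move=> M xM a aA; rewrite /= (le_trans _ (ltW xM))//.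
  rewrite [leLHS]mx_normrE; apply: bigmax_le => // -[i j] _ /=.
  rewrite ord1 ger0_norm ?(le_trans ler01) ?(calA_ge1 _ aA)//.
  rewrite (le_trans _ (ler_norm _))//; have [_ _ <-] := aA.
  rewrite (bigD1 j)//= lerDl sumr_ge0// => k _.
  by rewrite (le_trans ler01) ?(calA_ge1 _ aA).
- rewrite (_ : calA _ =
    (\bigcap_(i in [set i : 'I_n | i = 0%N :> nat])
        (fun a : 'rV[R]_n => a 0 i) @^-1` [set 1]) `&`
    ((\bigcap_(p in [set p : 'I_n * 'I_n | (p.1 <= p.2)%N])
        (fun a : 'rV[R]_n => a 0 p.2 - a 0 p.1) @^-1` [set y | 0 <= y]) `&`
     (fun a : 'rV[R]_n => \sum_(i < n) a 0 i) @^-1` [set x])); last first.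
    apply/seteqP; split => [a [a0 aS ax]|a [a0 [aS ax]]].
      split; first by move=> i i0; exact: a0.
      by split => // -[i j] ij /=; rewrite subr_ge0; exact: aS.
    split => // [i j ij]; rewrite -subr_ge0; exact: (aS (i, j)).
  apply: closedI; [|apply: closedI].
  + apply: closed_bigI => i _; apply: preimage_closed; last exact: closed_eq.
    by move=> a _; move: a; exact: coord_continuous.
  + apply: closed_bigI => p _; apply: preimage_closed; last exact: closed_ge.
    by move=> a _; apply: continuousB; exact: coord_continuous.
  + apply: preimage_closed; last exact: closed_eq.
    move=> a _; apply: continuous_big => [|i _]; last exact: coord_continuous.
    exact: add_continuous.
Qed.

Lemma F_at_min (R : realType) (n : nat) (x : R) :
  (1 < n)%N -> n%:R <= x ->
  exists a : 'rV[R]_n, [/\ calA x a, F_at n x = F_vec x a &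
    forall b : 'rV[R]_n, calA x b -> (F_vec x a <= F_vec x b)%E].
Proof.
move=> n1 nx.
pose g (i : 'I_n) (a : 'rV[R]_n) := A_ x a i / a 0 i.
pose f (a : 'rV[R]_n) := \big[Num.max/1]_(i < n) g i a.
have fE a : calA x a -> (f a)%:E = F_vec x a.
  move=> aA; apply/eqP; rewrite eq_le; apply/andP; split; last first.
    by apply: bigmax_le => [|i _]; rewrite ?leNye// lee_fin; exact: le_bigmax.
  have le_g i : ((g i a)%:E <= F_vec x a)%E.
    exact: (le_bigmax -oo%E (fun i => (g i a)%:E)).
  rewrite /f; elim/big_ind: _ => //.
    have i0 : (0 < n)%N by exact: ltnW.
    apply: le_trans (le_g (Ordinal i0)); rewrite lee_fin /g.
    have [a0 _ _] := aA; rewrite a0// divr1 /A_.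
    rewrite (big_pred1 (Ordinal i0)) => [|j]; last by rewrite /= leqn0.
    rewrite a0// subSS natrB; last exact: ltnW.
    have -> : (Ordinal i0).+1%:R = 1 :> R by [].
    by clear -nx; lra.
  by move=> u v; rewrite EFin_max ge_max => -> ->.
have cg i a : calA x a -> {for a, continuous (g i)}.
  move=> aA.
  have cS : {for a, continuous
      (fun b : 'rV[R]_n => \sum_(j < n | (j <= i)%N) b 0 j)}.
    apply: continuous_big => [|j _]; last exact: coord_continuous.
    exact: add_continuous.
  have cA : {for a, continuous (fun b : 'rV[R]_n => A_ x b i)}.
    by apply: continuousB cS; exact: cst_continuous.
  have cV : {for a, continuous (fun b : 'rV[R]_n => (b 0 i)^-1)}.
    apply: continuousV; last exact: coord_continuous.
    by rewrite gt_eqF// (lt_le_trans ltr01)// (calA_ge1 _ aA).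
  exact: continuousM cA cV.
have cf : {in @calA R n x, continuous f}.
  move=> a /set_mem aA.
  pose h (r : seq 'I_n) (b : 'rV[R]_n) := \big[Num.max/1]_(i <- r) g i b.
  suff ch r : {for a, continuous (h r)} by exact: (ch (index_enum _)).
  elim: r => [|i r IH].
    have -> : h [::] = cst 1 by apply/funext => b; rewrite /h big_nil.
    exact: cst_continuous.
  have -> : h (i :: r) = g i \max h r.
    by apply/funext => b; rewrite /h big_cons.
  by apply: continuous_max => //; exact: cg.
have [a /set_mem aA amin] := EVT_min_rV (calA_nonempty n1 nx)
  (@calA_compact R n x) (continuous_in_subspaceT cf).
have {}amin (b : 'rV[R]_n) : calA x b -> (F_vec x a <= F_vec x b)%E.
  by move=> bA; rewrite -(fE _ aA) -(fE _ bA) lee_fin amin// inE.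
exists a; split => //; apply/eqP; rewrite eq_le; apply/andP; split.
  by apply: ereal_inf_lbound; exists a.
by apply: le_ereal_inf_tmp => _ [b bA <-]; exact: amin.
Qed.

(* Main.v *)
Require Import Defs.
From mathcomp Require Import all_boot all_order all_algebra all_fingroup.
From mathcomp Require Import complex zify ring lra.
From mathcomp Require Import all_classical all_reals all_analysis.

(** Suppose that only finitely many [alpha] satisfy
    [|xi - alpha| <= H(alpha)^(-w-1)]. Summing [1 / (xi - alpha)] over the roots
    of an integer polynomial [p] of degree at most [n] gives
    [|p'(xi)| << |p(xi)| H(p)^(w+1)]; iterating this along the derivatives
    bounds [|p(xi)|] from below by a power of [H(p)], so there are irreducible
    [P] of large height [T] that are optimal up to factors [T^eps]. Let [v0] be a
    (nearly) best approximation of height slightly below [T] and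
    [delta = |v0(xi)|]; it is coprime to [P], and [v1 = P (X - c)^(n - deg P)]
    has degree [n] and is still coprime to [v0]. Complete [v0, v1] by successive
    minima [v2, ..., vn], reduced modulo [v0] so that all values at [xi] are at
    most [delta]. Minkowski's second theorem gives
    [H(v1) ... H(vn) << T^eps / delta].

    For [2 <= k <= n+1] and [m = n+1-k] the products [X^s v_j] with [s <= m] and
    [j < k] span all polynomials of degree at most [n+m], and one can select a
    basis of them using [2m+2] shifts of [v0, v1] and one further polynomial no
    larger than each of [v2, ..., v_(k-1)]. Its determinant is a nonzero integer
    and has one column of values and one column of derivatives at [xi]; hence
    [1 << delta^2 H(v_(k-1))^w T^(2m) H(v1) ... H(v_(k-1))]. In logarithms to
    base [T] the two estimates say [A_k <= w a_k + o(1)] for every [k]. *)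

Set Implicit Arguments.
Unset Strict Implicit.
Unset Printing Implicit Defensive.

Import Order.TTheory GRing.Theory Num.Theory.

Local Open Scope ring_scope.

(** * Linear independence and shifts of polynomials *)

(** A family is an infinite sequence with a separate length [M], so that one sequence can be
    truncated or extended without a change of type. *)
Definition spanned (F : fieldType) (V : lmodType F) (M : nat) (u : nat -> V)
    (p : V) : Prop :=
  exists c : nat -> F, p = \sum_(t < M) c t *: u t.

Definition indep (F : fieldType) (V : lmodType F) (M : nat) (u : nat -> V) :
    Prop :=
  forall c : nat -> F, \sum_(t < M) c t *: u t = 0 ->
    forall t, (t < M)%N -> c t = 0.

Lemma spanned_mem (F : fieldType) (V : lmodType F) (M : nat) (u : nat -> V)
    (t : nat) : (t < M)%N -> spanned M u (u t).
Proof.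
move=> tM; exists (fun s => (s == t)%:R).
rewrite (bigD1 (Ordinal tM))//= eqxx scale1r big1 ?addr0// => s.
by rewrite -val_eqE/= => /negbTE ->; rewrite scale0r.
Qed.

Lemma spannedD (F : fieldType) (V : lmodType F) (M : nat) (u : nat -> V)
    (p q : V) : spanned M u p -> spanned M u q -> spanned M u (p + q).
Proof.
move=> [c ->] [d ->]; exists (fun t => c t + d t).
by rewrite -big_split/=; apply: eq_bigr => t _; rewrite scalerDl.
Qed.

Lemma spannedZ (F : fieldType) (V : lmodType F) (M : nat) (u : nat -> V)
    (a : F) (p : V) : spanned M u p -> spanned M u (a *: p).
Proof.
move=> [c ->]; exists (fun t => a * c t).
by rewrite scaler_sumr; apply: eq_bigr => t _; rewrite scalerA.
Qed.

Lemma spanned0 (F : fieldType) (V : lmodType F) (M : nat) (u : nat -> V) :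
  spanned M u 0.
Proof. by exists (fun=> 0); rewrite big1// => t _; rewrite scale0r. Qed.

Lemma spanned_sum (F : fieldType) (V : lmodType F) (M : nat) (u : nat -> V)
    (k : nat) (c : nat -> F) (p : nat -> V) :
  (forall t, (t < k)%N -> spanned M u (p t)) ->
  spanned M u (\sum_(t < k) c t *: p t).
Proof.
move=> H; elim/big_ind: _ => [||t _]; first exact: spanned0.
  by move=> x y; exact: spannedD.
by apply: spannedZ; exact: H.
Qed.

Lemma spanned_trans (F : fieldType) (V : lmodType F) (M k : nat)
    (u v : nat -> V) (p : V) :
  (forall t, (t < k)%N -> spanned M u (v t)) -> spanned k v p -> spanned M u p.
Proof. by move=> H [c ->]; exact: spanned_sum. Qed.

Lemma spannedW (F : fieldType) (V : lmodType F) (M k : nat) (u : nat -> V)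
    (p : V) : (k <= M)%N -> spanned k u p -> spanned M u p.
Proof.
move=> kM; apply: spanned_trans => t tk.
exact: spanned_mem (leq_trans tk kM).
Qed.

(** If [M < k], the matrix of coordinates of the [v t] has a nonzero left kernel vector, which is a
    linear relation between them. *)
Lemma indep_leq (F : fieldType) (V : lmodType F) (M k : nat)
    (u v : nat -> V) :
  indep k v -> (forall t, (t < k)%N -> spanned M u (v t)) -> (k <= M)%N.
Proof.
move=> iv sv; rewrite leqNgt; apply/negP => Mk.
have /fin_all_exists[C HC] : forall i : 'I_k,
    exists c : nat -> F, v i = \sum_(t < M) c t *: u t.
  by move=> i; exact: (sv _ (ltn_ord i)).
pose A : 'M[F]_(k, M) := \matrix_(i, j) C i j.
have : kermx A != 0.
  by rewrite kermx_eq0 /row_free neq_ltn (leq_ltn_trans (rank_leq_col A) Mk).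
move=> /rowV0Pn[x /sub_kermxP xA /eqP x0]; apply: x0.
pose c t := if insub t is Some j then x 0 j else 0.
have cE (i : 'I_k) : x 0 i = c i by rewrite /c valK.
apply/rowP => i; rewrite mxE cE; apply: (iv c) (ltn_ord i).
transitivity (\sum_(i < k) \sum_(t < M) (x 0 i * C i t) *: u t).
  apply: eq_bigr => j _; rewrite -cE HC scaler_sumr.
  by apply: eq_bigr => t _; rewrite scalerA.
rewrite exchange_big/= big1// => t _; rewrite -scaler_suml.
suff -> : \sum_(j < k) x 0 j * C j t = (x *m A) 0 t by rewrite xA mxE scale0r.
by rewrite mxE; apply: eq_bigr => j _; rewrite mxE.
Qed.

Lemma eq_indep (F : fieldType) (V : lmodType F) (M : nat) (u v : nat -> V) :
  (forall t, (t < M)%N -> u t = v t) -> indep M u -> indep M v.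
Proof.
move=> uv iu c H; apply: iu; rewrite -[RHS]H.
by apply: eq_bigr => t _; rewrite uv.
Qed.

Lemma eq_spanned (F : fieldType) (V : lmodType F) (M : nat) (u v : nat -> V)
    (p : V) :
  (forall t, (t < M)%N -> u t = v t) -> spanned M u p -> spanned M v p.
Proof.
by move=> uv [c ->]; exists c; apply: eq_bigr => t _; rewrite uv.
Qed.

Lemma indep_recr (F : fieldType) (V : lmodType F) (M : nat) (u : nat -> V) :
  indep M u -> ~ spanned M u (u M) -> indep M.+1 u.
Proof.
move=> iu nu c; rewrite big_ord_recr/= => H.
have cM : c M = 0.
  apply/eqP/negP => /negP cM; apply: nu.
  exists (fun t => - (c M)^-1 * c t).
  transitivity (- (c M)^-1 *: \sum_(t < M) c t *: u t).
    move/eqP: H; rewrite addr_eq0 => /eqP ->.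
    by rewrite scalerN scaleNr opprK scalerA mulVf// scale1r.
  by rewrite scaler_sumr; apply: eq_bigr => t _; rewrite scalerA.
move: H; rewrite cM scale0r addr0 => H t.
by rewrite ltnS leq_eqVlt => /predU1P[->//|]; exact: iu.
Qed.

Lemma indepW (F : fieldType) (V : lmodType F) (M k : nat) (u : nat -> V) :
  (k <= M)%N -> indep M u -> indep k u.
Proof.
move=> kM iu c H t tk.
have := iu (fun s => if (s < k)%N then c s else 0) _ t (leq_trans tk kM).
rewrite tk; apply.
transitivity (\sum_(s < M | (s < k)%N) c s *: u s).
  by rewrite [RHS]big_mkcond; apply: eq_bigr => s _; case: ifP;
    rewrite ?scale0r.
by rewrite -(big_ord_widen M (fun t => c t *: u t)).
Qed.

(** The value [p] is taken at every index from [M] on; thus [upd (fun=> v0) 1 v1] stands for the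
    pair [v0], [v1]. *)
Definition upd (V : Type) (u : nat -> V) (M : nat) (p : V) (t : nat) : V :=
  if (t < M)%N then u t else p.

Lemma indep_upd (F : fieldType) (V : lmodType F) (M : nat) (u : nat -> V)
    (p : V) : indep M u -> ~ spanned M u p -> indep M.+1 (upd u M p).
Proof.
move=> iu np; apply: indep_recr.
  by apply: eq_indep iu => t tM; rewrite /upd tM.
rewrite {2}/upd ltnn => /eq_spanned sp; apply: np; apply: sp => t tM.
by rewrite /upd tM.
Qed.

Lemma size_spanned (F : fieldType) (M N : nat) (u : nat -> {poly F})
    (p : {poly F}) :
  (forall t, (t < M)%N -> (size (u t) <= N)%N) -> spanned M u p ->
  (size p <= N)%N.
Proof.
move=> su [c ->]; apply: (leq_trans (size_sum _ _ _)).
apply/bigmax_leqP => t _; apply: leq_trans (size_scale_leq _ _) _.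
exact: su.
Qed.

Lemma indepXn (F : fieldType) (N : nat) :
  indep N (fun i => 'X^i : {poly F}).
Proof.
move=> c; rewrite -poly_def => H t tN.
by have /(congr1 (fun p : {poly F} => p`_t)) := H; rewrite coef_poly tN coef0.
Qed.

Lemma size_XnM_leq (F : comNzRingType) (p : {poly F}) (s m n : nat) :
  (size p <= n)%N -> (s <= m)%N -> (size ('X^s * p)%R <= n + m)%N.
Proof.
move=> pn sm; rewrite mulrC.
apply: leq_trans (size_polyMleq _ _) _; rewrite size_polyXn addnS/=.
exact: leq_add.
Qed.

(* Modulo [v 1] the span of the shifts grows by at least one dimension at each
   further shift: otherwise it is stable under multiplication by ['X] and, as it
   contains [v 0], a unit modulo [v 1], it is everything. *)
Lemma shift_indep (F : fieldType) (n m k i : nat) (v : nat -> {poly F}) :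
  (m + k = n.+1)%N -> (0 < i < k)%N ->
  (forall j, (j < k)%N -> (size (v j) <= n.+1)%N) ->
  size (v 1%N) = n.+1 -> coprimep (v 0%N) (v 1%N) -> indep k v ->
  exists s j : nat -> nat,
    (forall t, (t < 2 * m + i.+1)%N -> (s t <= m)%N /\ (j t <= i)%N) /\
    indep (2 * m + i.+1) (fun t => 'X^(s t) * v (j t)).
Proof.
move=> mk /andP[i0 ik] sv sv1 cop iv.
(* The parameter [e] limits only the shifts of the [v j] with [j] other than 1, while [v 1] may be
   shifted up to [m] from the start; at [e = m] the family has the wanted length. *)
suff H e : (e <= m)%N -> exists s j : nat -> nat,
    let M := (m + e + i.+1)%N in
    let u t := 'X^(s t) * v (j t) in
    [/\ forall t, (t < M)%N ->
          [/\ s t <= m, j t <= i & (j t == 1) || (s t <= e)]%N,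
        forall l, (l <= m)%N -> spanned M u ('X^l * v 1%N),
        spanned M u (v 0%N) & indep M u].
  have [s [j /= [sj _ _ ij]]] := H m (leqnn m); exists s, j.
  by rewrite mul2n -addnn; split => // t /sj[].
elim: e => [_|e IHe em].
  suff B l : (l <= m)%N ->
      let u t := 'X^(if (t <= i)%N then 0%N else (t - i)%N) *
                 v (if (t <= i)%N then t else 1%N) in
      indep (l + i.+1) u.
    exists (fun t => if (t <= i)%N then 0%N else (t - i)%N).
    exists (fun t => if (t <= i)%N then t else 1%N) => /=; rewrite addn0; split.
    - by move=> t tM; case: (leqP t i) => ti; split=> //=; rewrite ?orbT//; lia.
    - move=> [_|l lm].
        have := @spanned_mem F _ (m + i.+1) (fun t =>
          'X^(if (t <= i)%N then 0%N else (t - i)%N) *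
          v (if (t <= i)%N then t else 1%N)) 1%N.
        by rewrite i0; apply; lia.
      have := @spanned_mem F _ (m + i.+1) (fun t =>
          'X^(if (t <= i)%N then 0%N else (t - i)%N) *
          v (if (t <= i)%N then t else 1%N)) (l.+1 + i)%N.
      rewrite (_ : (l.+1 + i <= i)%N = false) ?addnK; last lia.
      by apply; lia.
    - have := @spanned_mem F _ (m + i.+1) (fun t =>
          'X^(if (t <= i)%N then 0%N else (t - i)%N) *
          v (if (t <= i)%N then t else 1%N)) 0%N.
      by rewrite leq0n expr0 mul1r; apply; lia.
    - exact: B.
  elim: l => [_|l IHl lm] u.
    apply: (@eq_indep _ _ _ v) (indepW _ iv) => // t.
    by rewrite add0n ltnS /u => ->; rewrite expr0 mul1r.
  rewrite addSn; apply: indep_recr; first by apply: IHl; lia.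
  move=> /(@size_spanned _ _ (n.+1 + l)); rewrite /u.
  rewrite (_ : (l + i.+1 <= i)%N = false); last lia.
  rewrite (_ : l + i.+1 - i = l.+1)%N; last lia.
  rewrite mulrC size_mulXn -?size_poly_eq0 sv1//;
    suff: ~ (n.+1 + l.+1 <= n.+1 + l)%N.
    rewrite addnC => nl H; apply: nl; apply: H => t tM.
    apply: size_XnM_leq; last by case: ifP => //; lia.
    by apply: sv; case: ifP => //; lia.
  lia.
have [s [j /= [sj s1 s0 ij]]] := IHe (ltnW em).
set M := (m + e + i.+1)%N in sj s1 s0 ij *.
set u := (fun t => _) in s1 s0 ij *.
have [[a [b [ae bi nab]]]|all_sp] := pselect (exists a b,
    [/\ (a <= e.+1)%N, (b <= i)%N & ~ spanned M u ('X^a * v b)]).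
  exists (upd s M a), (upd j M b) => /=.
  rewrite (_ : (m + e.+1 + i.+1)%N = M.+1); last by rewrite /M; lia.
  have uE t : (t < M)%N -> u t = 'X^(upd s M a t) * v (upd j M b t).
    by rewrite /u /upd => ->.
  split.
  - move=> t; rewrite ltnS /upd => tM; case: ltnP => [tlt|_].
      have [? ? /orP[->//|?]] := sj t tlt; split => //.
      by apply/orP; right; lia.
    by split => //; [lia|rewrite ae orbT].
  - by move=> l lm; apply: spannedW (leqnSn M) _; apply: eq_spanned uE _;
      exact: s1.
  - by apply: spannedW (leqnSn M) _; apply: eq_spanned uE _.
  - apply: eq_indep (indep_upd ij nab) => t _; rewrite /upd /u.
    by case: ifP.
exfalso.
have {}all_sp a b : (a <= e.+1)%N -> (b <= i)%N -> spanned M u ('X^a * v b).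
  by move=> ae bi; apply: contrapT => H; apply: all_sp; exists a, b.
(* [I] consists of the polynomials congruent modulo [v 1] to an element of the span. It contains all
   multiples of [v 0] and of [v 1], hence everything by Bezout. *)
pose I (p : {poly F}) := exists q : {poly F}, spanned M u (p - v 1%N * q).
have I_span p : spanned M u p -> I p by exists 0; rewrite mulr0 subr0.
have I_v1 q : I (v 1%N * q) by exists q; rewrite subrr; exact: spanned0.
have ID p q : I p -> I q -> I (p + q).
  move=> [a Ha] [b Hb]; exists (a + b); rewrite mulrDr opprD addrACA.
  exact: spannedD.
have IZ c p : I p -> I (c *: p).
  by move=> [a Ha]; exists (c *: a); rewrite -scalerAr -scalerBr;
    exact: spannedZ.
have IX p : I p -> I ('X * p).
  move=> [q [c pq]].
  rewrite -(subrK (v 1%N * q) p) mulrDr pq mulrCA.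
  apply: (ID _ _ _ (I_v1 _)); rewrite mulr_sumr.
  apply: (big_ind I) => [||t _]; [exact/I_span/spanned0|exact: ID|].
  rewrite -scalerAr; apply: IZ; rewrite /u mulrA -exprS.
  have [_ ti /orP[/eqP ->|se]] := sj t (ltn_ord t); first by rewrite mulrC;
    exact: I_v1.
  by apply: I_span; apply: all_sp.
have Iv0 a : I (a * v 0%N).
  elim/poly_ind: a => [|a c Ia]; first by rewrite mul0r; exact/I_span/spanned0.
  rewrite mulrDl (mulrC a) -mulrA; apply: ID; first exact: IX.
  by rewrite mul_polyC; apply/IZ/I_span.
have IT p : I p.
  have /Bezout_eq1_coprimepP[[a b] /= ab] := cop.
  rewrite -[p]mulr1 -ab mulrDr !mulrA; apply: ID; first exact: Iv0.
  by rewrite mulrC; exact: I_v1.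
have su t : (t < M)%N -> (size (u t) <= n.+1 + m)%N.
  move=> /sj[st ti _]; apply: size_XnM_leq => //; apply: sv.
  exact: leq_ltn_trans ti ik.
(* For [p] of this size the cofactor [q] has degree at most [m], so [v 1%N * q] combines shifts
   already in the span. The span then has dimension at least [n.+1 + m], which exceeds [M] because
   [e < m] and [i < k]. *)
have full (p : {poly F}) : (size p <= n.+1 + m)%N -> spanned M u p.
  move=> sp; have [q pq] := IT p.
  rewrite -(subrK (v 1%N * q) p); apply: spannedD => //.
  have [->|q0] := eqVneq q 0; first by rewrite mulr0; exact: spanned0.
  have : (size (v 1%N * q)%R <= n.+1 + m)%N.
    rewrite -[v 1%N * q](subKr p); apply: leq_trans (size_polyD _ _) _.
    by rewrite geq_max sp size_polyN; exact: (size_spanned su).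
  have v10 : v 1%N != 0 by rewrite -size_poly_eq0 sv1.
  rewrite size_mul// sv1 => sq.
  rewrite -[q]coefK poly_def mulr_sumr.
  apply: (big_ind (spanned M u)) => [||t _]; [exact: spanned0|exact: spannedD|].
  rewrite -scalerAr mulrC; apply/spannedZ/s1.
  rewrite -ltnS; apply: leq_trans (ltn_ord t) _.
  by move: sq; rewrite addSn/= addSn -addnS leq_add2l.
have := indep_leq (@indepXn F (n.+1 + m)) (u := u) (M := M).
suff: (M < n.+1 + m)%N.
  move=> Mn H; suff: (n.+1 + m <= M)%N by rewrite leqNgt Mn.
  by apply: H => t tn; apply: full; rewrite size_polyXn.
by rewrite /M; clear -em ik mk; lia.
Qed.

(** Starting from [2 * m + 2] shifts of [v 0] and [v 1], an exchange step adds one polynomial for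
    each further index. The resulting bound on [j t] keeps the determinant of the family small. *)
Lemma shift_family (F : fieldType) (n m k : nat) (v : nat -> {poly F}) :
  (m + k = n.+1)%N -> (1 < k)%N ->
  (forall j, (j < k)%N -> (size (v j) <= n.+1)%N) ->
  size (v 1%N) = n.+1 -> coprimep (v 0%N) (v 1%N) -> indep k v ->
  exists s j : nat -> nat,
    (forall t, (t < 2 * m + k)%N ->
       [/\ s t <= m, j t < k & j t <= maxn 1 (t - 2 * m)]%N) /\
    indep (2 * m + k) (fun t => 'X^(s t) * v (j t)).
Proof.
move=> mk k1 sv sv1 cop iv.
suff H i : (0 < i < k)%N -> exists s j : nat -> nat,
    (forall t, (t < 2 * m + i.+1)%N ->
       [/\ s t <= m, j t <= i & j t <= maxn 1 (t - 2 * m)]%N) /\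
    indep (2 * m + i.+1) (fun t => 'X^(s t) * v (j t)).
  have [|s [j]] := H k.-1; first lia.
  rewrite prednK; last lia.
  move=> [sj ij]; exists s, j; split => // t /sj[st jt jm]; split => //; lia.
elim: i => [//|[_ _|i IHi ik]].
  have [|s [j [sj ij]]] := @shift_indep F n m k 1 v mk _ sv sv1 cop iv;
    first lia.
  exists s, j; split => // t /sj[st jt]; split => //; lia.
have [|s [j [sj ij]]] := IHi; first lia.
have [|s' [j' [sj' ij']]] := @shift_indep F n m k i.+2 v mk _ sv sv1 cop iv;
  first lia.
set M := (2 * m + i.+2)%N in sj ij *.
set u := (fun t => _) in ij.
(* The longer independent family from [shift_indep] cannot lie in the span of [M] vectors; a member
   outside is appended at position [M], where [M - 2 * m = i.+2]. *)
have [[t [tM nt]]|all_sp] := pselect (exists t, (t < 2 * m + i.+3)%N /\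
    ~ spanned M u ('X^(s' t) * v (j' t))); last first.
  have := indep_leq ij'; move=> /(_ M u); suff: (M < 2 * m + i.+3)%N.
    move=> ML H; suff: (2 * m + i.+3 <= M)%N by rewrite leqNgt ML.
    by apply: H => t tM; apply: contrapT => nt; apply: all_sp; exists t.
  by rewrite /M !addnS.
exists (upd s M (s' t)), (upd j M (j' t)); rewrite addnS -/M; split.
  move=> r; rewrite /upd ltnS => rM; case: (ltnP r M) => rM'.
    by have [? ? ?] := sj r rM'; split => //; lia.
  have [? ?] := sj' t tM; split=> //; rewrite /M in rM'; lia.
apply: eq_indep (indep_upd ij nt) => r _; rewrite /upd /u; by case: ifP.
Qed.

(** * Minkowski's second theorem by pigeonhole *)

Definition ev (R : realType) (xi : R) (p : {poly int}) : R :=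
  (map_poly intr p).[xi].

Definition polyQ (p : {poly int}) : {poly rat} := map_poly intr p.

(** The Smith form of the first row supplies a unimodular column operation clearing it beyond its
    first entry; the remaining block is treated recursively. In the coordinates [z *m U], a
    combination of the first [k] rows of [M] vanishes from position [k] on. *)
Lemma int_triangular (N : nat) (M : 'M[int]_N) :
  exists2 U : 'M[int]_N, U \in unitmx &
    forall i j : 'I_N, (i < j)%N -> (M *m U) i j = 0.
Proof.
elim: N M => [|N IHN] M; first by exists 1%:M; [exact: unitmx1|case].
have [L _ [K Ku [d _ rE]]] :=
  int_Smith_normal_form (usubmx (M : 'M[int]_(1 + N))).
pose M' := (M : 'M[int]_(1 + N)) *m invmx K.
have ur0 : ursubmx M' = 0.
  apply/matrixP => a b; rewrite /M' /ursubmx -mul_usub_mx rE mulmxK//.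
  rewrite mxE mxE big1 ?mxE// => i _.
  by rewrite !ord1 [X in _ * X]mxE/= mulr0.
have [V Vu VT] := IHN (drsubmx M').
pose W : 'M[int]_(1 + N) := block_mx 1%:M 0 0 V.
have Wu : W \in unitmx.
  by rewrite unitmxE det_ublock det1 mul1r.
exists (invmx K *m W); first by rewrite unitmx_mul unitmx_inv Ku.
suff H (i j : 'I_(1 + N)) : (i < j)%N -> (M' *m W : 'M[int]_(1 + N)) i j = 0.
  by move=> i j; rewrite mulmxA; exact: H.
have -> : M' *m W = block_mx (ulsubmx M') (ursubmx M' *m V) (dlsubmx M')
    (drsubmx M' *m V).
  by rewrite -{1}[M']submxK mulmx_block !mulmx1 !mulmx0 !addr0 !add0r.
rewrite ur0 mul0mx; case: (split_ordP i) => a ->; case: (split_ordP j) => b ->.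
- by rewrite !ord1.
- by rewrite block_mxEur mxE.
- by rewrite ord1.
- by rewrite block_mxEdr /= ltn_add2l; exact: VT.
Qed.

Lemma evB (R : realType) (xi : R) (p q : {poly int}) :
  ev xi (p - q) = ev xi p - ev xi q.
Proof. by rewrite /ev rmorphB hornerD hornerN. Qed.

Lemma evM (R : realType) (xi : R) (p q : {poly int}) :
  ev xi (p * q) = ev xi p * ev xi q.
Proof. by rewrite /ev rmorphM hornerM. Qed.

Lemma evZ (R : realType) (xi : R) (c : int) (p : {poly int}) :
  ev xi (c *: p) = c%:~R * ev xi p.
Proof. by rewrite /ev map_polyZ hornerZ. Qed.

Lemma coef_polyQ (p : {poly int}) (i : nat) : (polyQ p)`_i = (p`_i)%:~R.
Proof. by rewrite coef_map. Qed.

Lemma prod_card_ord (N : nat) (m : nat -> nat) :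
  #|{dffun forall i : 'I_N, 'I_(m i)}| = (\prod_(i < N) m i)%N.
Proof.
rewrite card_dep_ffun foldrE big_map enumT.
by apply: eq_bigr => i _; rewrite card_ord.
Qed.

(* Pigeonhole form of Minkowski's second theorem: colour the integer points of a
   box by their residues in coordinates adapted to the flag spanned by the [v j]
   (with moduli about [h / mu i]) and by the position of their value at [xi];
   points with equal colours coincide. *)
Lemma prod_minima_le (R : realType) (xi B s : R) (N : nat)
    (v : nat -> {poly int}) (mu : nat -> nat) :
  (0 < N)%N -> 0 < s ->
  (forall (p : {poly int}) (h : nat), (size p <= N)%N ->
     (forall i, (`|p`_i| <= h%:Z)) -> `|ev xi p| <= B * h%:R) ->
  (forall i, (i < N)%N -> (2 <= mu i)%N) ->
  (forall i j, (i <= j < N)%N -> (mu i <= mu j)%N) ->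
  (forall i (h : nat) (p : {poly int}), (i < N)%N -> (h < mu i)%N ->
     (size p <= N)%N ->
     (forall l, `|p`_l| <= h%:Z) -> `|ev xi p| <= s * h%:R ->
     spanned i (fun j => polyQ (v j)) (polyQ p)) ->
  \prod_(i < N) (mu i)%:R <= 4 ^+ N * (2 * B / s + 1).
Proof.
move=> N0 s0 HB mu2 mumono Hspan.
have [U Uu UT] := int_triangular (\matrix_(j < N, i < N) (v j)`_i).
pose h := mu N.-1.
have muh i : (i < N)%N -> (mu i <= h)%N by move=> iN; apply: mumono; lia.
(* The modulus [2 ^ e i] lies between [2 * h / mu i] and [4 * h / mu i]. Powers of two make the
   moduli of larger minima divide those of smaller ones. *)
pose e i := (trunc_log 2 (h %/ mu i)).+2.
have e_ge i : (i < N)%N -> (2 * h <= 2 ^ e i * mu i)%N.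
  move=> iN; have m0 : (0 < mu i)%N by have := mu2 i iN; lia.
  have := @trunc_log_ltn 2 (h %/ mu i) isT; rewrite /e.
  by rewrite ltn_divLR// => H; rewrite expnS -mulnA leq_pmul2l// ltnW.
have e_le i : (i < N)%N -> (2 ^ e i * mu i <= 4 * h)%N.
  move=> iN; have m0 : (0 < mu i)%N by have := mu2 i iN; lia.
  have : (0 < h %/ mu i)%N by rewrite divn_gt0// muh.
  move=> /(@trunc_logP 2 _ isT); rewrite leq_divRL// /e !expnS => H.
  by rewrite -!mulnA mulnA leq_pmul2l.
have e_dvd i k : (i <= k < N)%N -> (2 ^ e k %| 2 ^ e i)%N.
  move=> ik; apply: dvdn_exp2l; rewrite /e !ltnS; apply: leq_trunc_log.
  by apply: leq_div2l; [have := mu2 i; lia|exact: mumono].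
have h0 : (0 < h)%N.
  by have := mu2 0%N N0; have := muh 0%N N0; lia.
have h0R : 0 < h%:R :> R by rewrite ltr0n.
pose T := {ffun 'I_N -> 'I_h.+1}.
pose pt (x : T) : 'rV[int]_N := \row_i (x i : nat)%:Z.
have pt_inj : injective pt.
  move=> x y /rowP xy; apply/ffunP => i; apply: val_inj.
  by have := xy i; rewrite !mxE => -[].
(* The values at [xi] lie within [B * h] of 0, and [b] intervals of length [s * h] cover that
   range. *)
pose b := (Num.trunc (2 * B / s)).+1.
have HBx (x : T) : `|ev xi (rVpoly (pt x))| <= B * h%:R.
  apply: HB => [|i]; first exact: size_poly.
  rewrite coef_rVpoly; case: insubP => [j _ _|_]; last by rewrite normr0.
  by rewrite mxE /=; have := ltn_ord (x j); lia.
have B0 : 0 <= B.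
  have := HB 0 1%N; rewrite size_poly0 /ev rmorph0 horner0 normr0 mulr1; apply.
    by [].
  by move=> i; rewrite coef0.
have sh0 : 0 < s * h%:R by rewrite mulr_gt0.
pose w (x : T) := (ev xi (rVpoly (pt x)) + B * h%:R) / (s * h%:R).
have w0 x : 0 <= w x.
  apply: divr_ge0; last exact: ltW.
  by have := HBx x; rewrite ler_norml; lra.
have wb x : (Num.trunc (w x) < b)%N.
  rewrite ltnS; apply: le_truncn; rewrite /w ler_pdivrMr//.
  rewrite (_ : 2 * B / s * (s * h%:R) = 2 * (B * h%:R)); last first.
    by field; rewrite gt_eqF.
  by have := HBx x; rewrite ler_norml; lra.
pose y (x : T) (i : 'I_N) : int := (pt x *m U) 0 i.
have col_lt (x : T) (i : 'I_N) : (absz (y x i %% (2 ^ e i)%:Z)%Z < 2 ^ e i)%N.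
  have q0 : 0 < (2 ^ e i)%:Z by rewrite ltz_nat expn_gt0.
  by rewrite -ltz_nat gez0_abs ?ltz_pmod// modz_ge0// gt_eqF.
pose col (x : T) : {dffun forall i : 'I_N, 'I_(2 ^ e i)} :=
  [ffun i => Ordinal (col_lt x i)].
pose f (x : T) := (col x, Ordinal (wb x)).
(* Let [d] be the difference of two distinct points of equal colour and [k] the last nonzero
   coordinate of [d *m U]. All coordinates are divisible by [q = 2 ^ e k], and [z = d / q] is an
   integer point of height at most [mu k / 2] with a correspondingly small value. Hence [z] lies in
   the span of the first [k] of the [v j], where coordinate [k] vanishes. *)
have f_inj : injective f.
  move=> x x' [/ffunP xyc xyw]; apply/eqP; rewrite -(inj_eq pt_inj) -subr_eq0.
  apply/negPn/negP => d0.
  set d := pt x - pt x' in d0.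
  have dU0 : d *m U != 0.
    by apply: contra d0 => /eqP H; rewrite -[d](mulmxK Uu) H mul0mx.
  have [i0 i0P] : exists i0, (d *m U) 0 i0 != 0.
    by have /rV0Pn := dU0.
  have [k kP kmax] := @arg_maxnP _ i0 [pred i | (d *m U) 0 i != 0] val i0P.
  have dvd_i i : ((2 ^ e i)%:Z %| (d *m U) 0%R i)%Z.
    have := xyc i; rewrite !ffunE => -[] /(congr1 Posz).
    have q0 : (2 ^ e i)%:Z != 0 by rewrite eqz_nat expn_eq0.
    rewrite !gez0_abs ?modz_ge0// => /eqP.
    by rewrite eqz_mod_dvd /d /y mulmxBl !mxE.
  have dvd_k i : ((2 ^ e k)%:Z %| (d *m U) 0%R i)%Z.
    have [->|di] := eqVneq ((d *m U) 0 i) 0; first exact: dvdz0.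
    apply: dvdz_trans (dvd_i i); rewrite dvdzE /=; apply: e_dvd.
    by rewrite ltn_ord andbT; exact: kmax.
  pose q : int := (2 ^ e k)%:Z.
  have q0 : 0 < q by rewrite ltz_nat expn_gt0.
  pose z' : 'rV[int]_N := \row_i ((d *m U) 0%R i %/ q)%Z.
  pose z := z' *m invmx U.
  have dUz : d *m U = q *: z'.
    by apply/rowP => i; rewrite [RHS]mxE /z' [X in q * X]mxE mulrC divzK.
  have dz : d = q *: z by rewrite -[LHS](mulmxK Uu) /z scalemxAl dUz.
  have eh : (2 * h <= 2 ^ e k * mu k)%N by exact: e_ge.
  have mk := mu2 k (ltn_ord k).
  have : spanned k (fun j => polyQ (v j)) (polyQ (rVpoly z)).
    apply: (Hspan _ (mu k).-1) => //; first lia.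
    - exact: size_poly.
    - move=> l; rewrite coef_rVpoly; case: insubP => [j _ _|_];
        last by rewrite normr0.
      have : `|d 0 j| <= h%:Z.
        by rewrite /d !mxE; have := ltn_ord (x j); have := ltn_ord (x' j); lia.
      rewrite dz mxE normrM (gtr0_norm q0) => qz.
      have : q * (2 * `|z 0 j|) <= q * (mu k)%:Z.
        rewrite mulrCA; apply: le_trans (_ : (2 * h)%:Z <= _).
          by rewrite PoszM ler_pM2l.
        by rewrite /q -PoszM lez_nat.
      rewrite ler_pM2l//; move: (`|z 0 j|) mk => a; clear; lia.
    - have : `|ev xi (rVpoly d)| <= s * h%:R.
        rewrite /d linearB evB.
        have : w x - w x' = (ev xi (rVpoly (pt x)) - ev xi (rVpoly (pt x'))) / (s * h%:R).
          by rewrite /w -mulrBl; congr (_ / _); ring.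
        move=> /(congr1 (fun t => t * (s * h%:R))); rewrite divfK ?gt_eqF// =>
          <-.
        rewrite normrM (gtr0_norm sh0) ler_piMl//; first exact: ltW.
        have := truncn_itv (w0 x); have := truncn_itv (w0 x').
        by rewrite xyw -!natr1 => ? ?; apply/ltW; rewrite ltr_norml; lra.
      have qR : 0 < q%:~R :> R by rewrite ltr0z.
      rewrite dz linearZ evZ normrM (gtr0_norm qR) => qs.
      rewrite -(ler_pM2l qR); apply: le_trans qs _.
      rewrite mulrCA ler_pM2l//.
      have eh' : 2 * h%:R <= (2 ^ e k)%:R * (mu k)%:R :> R.
        by rewrite -!natrM ler_nat.
      rewrite /q -pmulrn.
      have : 2 * (2 ^ e k)%:R * (mu k).-1%:R >= (2 ^ e k)%:R * (mu k)%:R :> R.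
        rewrite -!natrM ler_nat -mulnA mulnCA leq_pmul2l ?expn_gt0//; lia.
      lra.
  move=> [c zc].
  have : z' 0 k = 0.
    have z'E : z' = z *m U by rewrite mulmxKV.
    apply/eqP; rewrite -(intr_eq0 rat) z'E mxE rmorph_sum/=; apply/eqP.
    transitivity (\sum_(i < N) (polyQ (rVpoly z))`_i * (U i k)%:~R).
      by apply: eq_bigr => i _; rewrite coef_polyQ coef_rVpoly_ord rmorphM.
    rewrite zc.
    transitivity (\sum_(i < N) \sum_(j < k) c j * ((v j)`_i * U i k)%:~R).
      apply: eq_bigr => i _; rewrite coef_sum mulr_suml; apply: eq_bigr => j _.
      by rewrite coefZ coef_polyQ rmorphM mulrA.
    rewrite exchange_big/= big1// => j _; rewrite -mulr_sumr -rmorph_sum/=.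
    have jN : (j < N)%N by exact: ltn_trans (ltn_ord j) (ltn_ord k).
    suff -> : \sum_(i < N) (v j)`_i * U i k = 0 by rewrite mulr0.
    rewrite -[RHS](UT (Ordinal jN) k (ltn_ord j)) mxE.
    by apply: eq_bigr => i _; rewrite mxE.
  by move=> z'0; have := kP; rewrite /= dUz mxE z'0 mulr0 eqxx.
have := leq_card f f_inj; rewrite card_ffun card_prod !card_ord.
rewrite (prod_card_ord _ (fun i => 2 ^ e i)%N) => le1.
have {}le1 : (h ^ N * \prod_(i < N) mu i <= 4 ^ N * h ^ N * b)%N.
  apply: leq_trans (_ : h.+1 ^ N * \prod_(i < N) mu i <= _)%N.
    by rewrite leq_mul2r leq_exp2r ?leqnSn ?orbT.
  apply: leq_trans (_ : (\prod_(i < N) 2 ^ e i) * b * \prod_(i < N) mu i <= _)%N.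
    by rewrite leq_mul2r le1 orbT.
  rewrite mulnAC -big_split/= leq_mul2r -expnMn; apply/orP; right.
  rewrite -[X in (_ <= _ ^ X)%N](card_ord N) -prod_nat_const.
  by apply: leq_prod => i _; exact: e_le.
have {}le1 : (\prod_(i < N) mu i <= 4 ^ N * b)%N.
  by move: le1; rewrite -mulnA mulnCA leq_pmul2l// expn_gt0 h0.
rewrite -natr_prod; apply: le_trans (_ : (4 ^ N * b)%:R <= _).
  by rewrite ler_nat.
rewrite natrM natrX ler_wpM2l ?exprn_ge0//.
rewrite /b -natr1 lerD2r; have /truncn_itv/andP[] // : 0 <= 2 * B / s.
by rewrite divr_ge0 ?mulr_ge0// ltW.
Qed.

(** * Determinants of independent integer polynomials *)

Lemma ev_wide (R : realType) (xi : R) (N : nat) (p : {poly int}) :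
  (size p <= N)%N -> ev xi p = \sum_(i < N) (p`_i)%:~R * xi ^+ i.
Proof.
move=> pN; rewrite /ev (horner_coef_wide (n := N)).
  by apply: eq_bigr => i _; rewrite coef_map.
exact: leq_trans (size_poly _ _) pN.
Qed.

Lemma ev_deriv_wide (R : realType) (xi : R) (N : nat) (p : {poly int}) :
  (size p <= N)%N ->
  ev xi p^`() = \sum_(i < N) (p`_i)%:~R * (xi ^+ i.-1 *+ i).
Proof.
case: N => [|N] pN.
  move: pN; rewrite leqn0 size_poly_eq0 => /eqP ->.
  by rewrite deriv0 big_ord0 /ev rmorph0 horner0.
rewrite (@ev_wide _ _ N) ?big_ord_recl ?mulr0n ?mulr0 ?add0r; last first.
  have [->|p0] := eqVneq p 0; first by rewrite deriv0 size_poly0.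
  by rewrite -ltnS; exact: leq_trans (lt_size_deriv p0) pN.
by apply: eq_bigr => i _; rewrite coef_deriv rmorphMn/= mulrnAl mulrnAr.
Qed.

Lemma normr_intr_ge1 (R : realType) (d : int) : d != 0 -> 1 <= `|d%:~R| :> R.
Proof. by move=> d0; rewrite -intr_norm ler1z; lia. Qed.

Lemma det_neq0 (N : nat) (u : nat -> {poly int}) :
  indep N (fun t =>
    polyQ (u t)) -> (forall t, (t < N)%N -> (size (u t) <= N)%N) ->
  \det (\matrix_(t < N, i < N) (u t)`_i) != 0.
Proof.
move=> iu su; apply/det0P => -[x /eqP x0 xM]; apply: x0.
pose c t : rat := if insub t is Some j then (x 0 j)%:~R else 0.
have cE (i : 'I_N) : (x 0 i)%:~R = c i by rewrite /c valK.
apply/rowP => i; rewrite mxE; apply/eqP; rewrite -(intr_eq0 rat) cE; apply/eqP.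
apply: (iu c) (ltn_ord i); apply/polyP => j; rewrite coef_sum coef0.
have [jN|jN] := ltnP j N; last first.
  by rewrite big1// => t _;
    rewrite coefZ coef_polyQ nth_default ?mulr0// (leq_trans (su t _)).
have := congr1 (fun m : 'rV_N => (m 0 (Ordinal jN))%:~R : rat) xM.
rewrite !mxE rmorph_sum/= => H; rewrite -[RHS]H; apply: eq_bigr => t _.
by rewrite coefZ coef_polyQ mxE rmorphM/= cE.
Qed.

(* Column operations turn the first two columns of the coefficient matrix into
   the values and the derivatives at [xi]. *)
Lemma det_ev_lower_bound (R : realType) (xi A B : R) (N : nat)
    (u : nat -> {poly int}) (g : nat -> R) :
  (1 < N)%N -> indep N (fun t => polyQ (u t)) ->
  (forall t, (t < N)%N -> (size (u t) <= N)%N) ->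
  (forall t i, (t < N)%N -> `|((u t)`_i)%:~R| <= g t) ->
  (forall t, (t < N)%N -> `|ev xi (u t)| <= A * g t) ->
  (forall t, (t < N)%N -> `|ev xi (u t)^`()| <= B * g t) ->
  1 <= N`!%:R * (A * B * \prod_(t < N) g t).
Proof.
case: N => [|[|N]]// _ iu su ug uA uB.
set n := N.+2 in iu su ug uA uB *.
pose M : 'M[int]_n := \matrix_(t < n, i < n) (u t)`_i.
(* [C] is lower triangular with unit diagonal: column 0 evaluates at [xi], column 1 evaluates the
   derivative ([*+ 0] gives the 0 in its first row), the others are those of the identity. *)
pose C : 'M[R]_n := \matrix_(j < n, l < n)
  if l == 0%N :> nat then xi ^+ j
  else if l == 1%N :> nat then xi ^+ j.-1 *+ j else (j == l)%:R.
have detC : \det C = 1.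
  rewrite det_trig.
    apply: big1 => i _; rewrite mxE eqxx.
    by case: eqP => [->|_]; [rewrite expr0|case: eqP => [->|]].
  apply/is_trig_mxP => i j ij; rewrite mxE.
  case: eqP => [j0|_]; first by rewrite j0 in ij.
  case: eqP => [j1|_]; last by rewrite -val_eqE/= ltn_eqF.
  by rewrite j1 ltnS leqn0 in ij; rewrite (eqP ij) mulr0n.
have h1 : 1 <= `|\det (map_mx intr M *m C)|.
  by rewrite det_mulmx detC mulr1 det_map_mx normr_intr_ge1// det_neq0.
apply: le_trans h1 _; rewrite /determinant.
pose k (l : 'I_n) : R :=
  if l == 0%N :> nat then A else if l == 1%N :> nat then B else 1.
have Mle (t l : 'I_n) : `|(map_mx intr M *m C) t l| <= k l * g t.
  rewrite /k; case: eqP => [l0|/eqP l0].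
    rewrite (_ : _ t l = ev xi (u t)); first exact: uA.
    rewrite mxE (@ev_wide _ _ n) ?su//; apply: eq_bigr => i _.
    by rewrite !mxE l0.
  case: eqP => [l1|/eqP l1].
    rewrite (_ : _ t l = ev xi (u t)^`()); first exact: uB.
    rewrite mxE (@ev_deriv_wide _ _ n) ?su//; apply: eq_bigr => i _.
    by rewrite !mxE l1.
  rewrite mul1r (_ : _ t l = ((u t)`_l)%:~R); first exact: ug.
  rewrite mxE (bigD1 l)//= !mxE (negbTE l0) (negbTE l1) eqxx mulr1.
  rewrite big1 ?addr0// => i il.
  by rewrite !mxE (negbTE l0) (negbTE l1) (negbTE il) mulr0.
apply: le_trans (ler_norm_sum _ _ _) _.
rewrite mulr_natl -card_Sn -sumr_const; apply: ler_sum => s _.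
rewrite normrM normrX normrN1 expr1n mul1r normr_prod.
apply: le_trans (_ : \prod_(i < n) (k (s i) * g i) <= _).
  by apply: ler_prod => i _; rewrite normr_ge0/=.
rewrite big_split/=.
have -> : \prod_(i < n) k (s i) = \prod_(i < n) k i.
  by rewrite [RHS](reindex_inj (@perm_inj _ s)).
rewrite /k.
by rewrite !big_ord_recl/= big1 ?mulr1// mulrA.
Qed.

(** * Heights *)

Lemma coef_le_height (p : {poly int}) (i : nat) :
  `|p`_i| <= (naive_height p)%:Z.
Proof.
have [ip|ip] := ltnP i (size p); last by rewrite nth_default// normr0.
have := @leq_bigmax _ (fun i : 'I_(size p) => `|(p`_i)%R|%N) (Ordinal ip).
by rewrite /naive_height /=; lia.
Qed.

Lemma coefR_le_height (R : realType) (p : {poly int}) (i : nat) :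
  `|(p`_i)%:~R| <= (naive_height p)%:R :> R.
Proof.
by have := coef_le_height p i; rewrite -intr_norm -(ler_int R).
Qed.

Lemma height_le (p : {poly int}) (h : nat) :
  (forall i, `|p`_i| <= h%:Z) -> (naive_height p <= h)%N.
Proof. by move=> H; apply/bigmax_leqP => i _; have := H i; lia. Qed.

Lemma height_leR (R : realType) (p : {poly int}) (h : R) : 0 <= h ->
  (forall i, `|(p`_i)%:~R| <= h) -> (naive_height p)%:R <= h.
Proof.
move=> h0 H; rewrite -truncn_ge_nat//; apply: height_le => i.
have := H i; rewrite -intr_norm -[`|p`_i|]gez0_abs// => hi.
by rewrite lez_nat truncn_ge_nat.
Qed.

Lemma height_gt0 (p : {poly int}) : p != 0 -> (0 < naive_height p)%N.
Proof.
move=> p0; have := coef_le_height p (size p).-1.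
have : p`_(size p).-1 != 0 by rewrite -lead_coefE lead_coef_eq0.
by lia.
Qed.

Lemma height_ge1 (R : realType) (p : {poly int}) :
  p != 0 -> 1 <= (naive_height p)%:R :> R.
Proof. by move=> /height_gt0; rewrite ler1n. Qed.

Lemma ev_le (R : realType) (xi : R) (N : nat) (p : {poly int}) (h : R) :
  (size p <= N)%N -> (forall i, `|(p`_i)%:~R| <= h) ->
  `|ev xi p| <= N%:R * (1 + `|xi|) ^+ N * h.
Proof.
move=> pN H; rewrite (ev_wide _ pN); apply: le_trans (ler_norm_sum _ _ _) _.
rewrite -mulrA mulr_natl -[X in _ *+ X]card_ord -sumr_const.
apply: ler_sum => i _; rewrite normrM normrX mulrC; apply: ler_pM => //.
apply: le_trans (_ : (1 + `|xi|) ^+ i <= _).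
  by rewrite lerXn2r ?nnegrE ?addr_ge0// lerDr.
by rewrite ler_weXn2l ?lerDl// ltnW.
Qed.

(** Newton interpolation: one node [x] is split off by dividing [f - f(x)] by ['X - x]. The values
    of the quotient at the other nodes are difference quotients, whose denominators are at least 1
    because the nodes are distinct integers. *)
Lemma interpolation_bound (R : realType) (d D : nat) :
  exists2 K : R, 0 < K & forall (f : {poly R}) (s : seq nat) (M : R),
    (size f <= d)%N -> (d <= size s)%N -> uniq s -> all (fun x =>
      (x <= D)%N) s ->
    0 <= M -> (forall x, x \in s -> `|f.[x%:R]| <= M) ->
    forall i, `|f`_i| <= K * M.
Proof.
elim: d => [|d [K K0 IHd]].
  exists 1 => // f s M; rewrite leqn0 size_poly_eq0 => /eqP -> _ _ _ M0 _ i.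
  by rewrite coef0 normr0 mul1r.
exists (1 + 2 * K + 2 * D%:R * K).
  by have := mulr_ge0 (ler0n R D) (ltW K0); lra.
move=> f [//|x s] M sf ss /= /andP[xs us] /andP[xD sD] M0 H.
have /factor_theorem[q fq] : root (f - f.[x%:R]%:P) x%:R.
  by rewrite rootE !hornerE subrr.
have {}fq : f = q * ('X - x%:R%:P) + f.[x%:R]%:P by rewrite -fq subrK.
have qH i : `|q`_i| <= K * (2 * M).
  apply: IHd ss us sD _ _ i; last 2 first.
  - by rewrite mulr_ge0.
  - move=> y ys.
    have yx : 1 <= `|y%:R - x%:R| :> R.
      have : y != x by apply: contraNneq xs => <-.
      by rewrite !pmulrn -intrB => yx; apply: normr_intr_ge1;
        rewrite subr_eq0 eqz_nat.
    have -> : q.[y%:R] = (f.[y%:R] - f.[x%:R]) / (y%:R - x%:R).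
      rewrite {1}fq !hornerE addrK mulfK// -normr_gt0.
      exact: lt_le_trans yx.
    rewrite normrM normfV ler_pdivrMr ?(lt_le_trans _ yx)//.
    apply: le_trans (_ : 2 * M <= _); last by rewrite ler_peMr ?mulr_ge0.
    apply: le_trans (ler_normB _ _) _; rewrite mulr_natl mulr2n.
    by rewrite lerD// H// inE ?eqxx// ys orbT.
  - have [->|q0] := eqVneq q 0; first by rewrite size_poly0.
    have : (size (q * ('X - x%:R%:P))%R <= d.+1)%N.
      rewrite (_ : q * _ = f - f.[x%:R]%:P); last by rewrite {1}fq addrK.
      apply: leq_trans (size_polyD _ _) _; rewrite geq_max sf size_polyN.
      by apply: leq_trans (size_polyC_leq1 _) _.
    by rewrite size_Mmonic ?monicXsubC// size_XsubC addn2/=.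
move=> i; rewrite fq coefD coefC mulrBr coefB coefMX coefMC.
have fx : `|f.[x%:R]| <= M by rewrite H// inE eqxx.
have xDR : x%:R <= D%:R :> R by rewrite ler_nat.
have h1 : `|if i == 0%N then 0 else q`_i.-1| <= K * (2 * M).
  by case: ifP => _ //; rewrite normr0 !mulr_ge0// ltW.
have h2 : `|q`_i * x%:R| <= K * (2 * M) * D%:R.
  by rewrite normrM ler_pM// ger0_norm.
have h3 : `|if i == 0%N then f.[x%:R] else 0| <= M.
  by case: ifP => // _; rewrite normr0.
apply: le_trans (ler_normD _ _) _.
apply: le_trans (lerD (ler_normB _ _) h3) _.
by move: h1 h2; lra.
Qed.

(** By interpolation, a polynomial of degree at most [n] is small relative to its height at no more
    than [n] of the nodes 0, ..., 2n. So at one of these nodes neither [f] nor [g] is small, and the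
    value of [f * g] there bounds its height from below. *)
Lemma height_mul_le (R : realType) (n : nat) :
  exists2 K : R, 0 < K & forall f g : {poly int},
    f != 0 -> g != 0 -> (size f <= n.+1)%N -> (size g <= n.+1)%N ->
    (naive_height f)%:R * (naive_height g)%:R <= K * (naive_height (f * g))%:R.
Proof.
have [K K0 HK] := @interpolation_bound R n.+1 (2 * n).
pose L : R := (2 * n).+1%:R * (1 + (2 * n)%:R) ^+ (2 * n).+1.
exists (4 * K ^+ 2 * L).
  by rewrite !mulr_gt0// ?exprn_gt0// ?ltr0n// ltr_pwDl.
move=> f g f0 g0 sf sg.
pose bad (p : {poly int}) (j : nat) :=
  2 * K * `|ev (j%:R : R) p| < (naive_height p)%:R.
have few (p : {poly int}) : p != 0 -> (size p <= n.+1)%N ->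
    (count (bad p) (iota 0 (2 * n).+1) <= n)%N.
  move=> p0 sp; rewrite leqNgt; apply/negP => cn.
  pose M : R := (naive_height p)%:R / (2 * K).
  have K2 : 0 < 2 * K by rewrite mulr_gt0.
  have /(HK (map_poly intr p) (seq.filter (bad p) (iota 0 (2 * n).+1)) M) :
      (size (map_poly intr p : {poly R}) <= n.+1)%N.
    exact: leq_trans (size_poly _ _) sp.
  rewrite size_filter => /(_ cn) H.
  have {}H i : `|(p`_i)%:~R : R| <= K * M.
    rewrite -coef_map; apply: H => {i}.
    - exact/filter_uniq/iota_uniq.
    - apply/allP => x; rewrite mem_filter => /andP[_].
      by rewrite mem_iota; lia.
    - by rewrite divr_ge0// ltW.
    - move=> x; rewrite mem_filter => /andP[xb _].
      by rewrite ler_pdivlMr// mulrC ltW.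
  have : (naive_height p)%:R <= K * M by apply: height_leR => //;
    exact: le_trans (H 0%N).
  rewrite /M (_ : K * _ = (naive_height p)%:R / 2); last by field;
    rewrite gt_eqF.
  by have := @height_ge1 R p p0; lra.
have [j jn /norP[/negP jf /negP jg]] :
    exists2 j, (j <= 2 * n)%N & ~~ (bad f j || bad g j).
  apply: contrapT => H.
  have : (count (predU (bad f) (bad g)) (iota 0 (2 * n).+1) = (2 * n).+1)%N.
    rewrite -[RHS](size_iota 0).
    apply/eqP; rewrite -all_count; apply/allP => j; rewrite mem_iota => jn.
    by apply/negPn/negP => nj; apply: H; exists j => //; lia.
  have := count_predUI (bad f) (bad g) (iota 0 (2 * n).+1).
  have := few f f0 sf; have := few g g0 sg; lia.
move: jf jg; rewrite /bad => /negP; rewrite -leNgt => jf /negP;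
  rewrite -leNgt => jg.
apply: le_trans (ler_pM _ _ jf jg) _ => //.
rewrite [leLHS](_ : _ = 4 * K ^+ 2 * `|ev (j%:R : R) (f * g)|); last first.
  by rewrite evM normrM; move: `|_| `|_| => x y; ring.
rewrite -(mulrA (4 * K ^+ 2)) ler_pM2l ?mulr_gt0 ?exprn_gt0//.
apply: le_trans (ev_le _ (N := (2 * n).+1) _ (@coefR_le_height R _)) _.
  by apply: leq_trans (size_polyMleq _ _) _; lia.
rewrite ler_wpM2r// ler_pM2l ?ltr0n// lerXn2r ?nnegrE ?addr_ge0//.
by rewrite lerD2l ger0_norm// ler_nat.
Qed.

Lemma height_dvd_le (R : realType) (n : nat) :
  exists2 K : R, 1 <= K & forall f g : {poly int},
    f != 0 -> g != 0 -> (size (f * g)%R <= n.+1)%N ->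
    (naive_height f)%:R <= K * (naive_height (f * g))%:R.
Proof.
have [K K0 HK] := @height_mul_le R n; exists (1 + K) => [|f g f0 g0 sfg].
  by rewrite lerDl ltW.
have sf : (0 < size f)%N by rewrite size_poly_gt0.
have sg : (0 < size g)%N by rewrite size_poly_gt0.
move: sfg; rewrite size_mul// => sfg.
have [sf' sg'] : (size f <= n.+1)%N /\ (size g <= n.+1)%N.
  by move: (size f) (size g) sf sg sfg => a b; lia.
apply: le_trans (_ : (naive_height f)%:R * (naive_height g)%:R <= _).
  by rewrite ler_peMr// height_ge1.
by apply: le_trans (HK f g f0 g0 sf' sg') _; rewrite ler_wpM2r// lerDr.
Qed.

(** * Factorization over the integers and minimal polynomials *)

(** Gauss's lemma, in the form [dvdpP_rat_int], turns a proper rational divisor into an integral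
    one. *)
Lemma int_reducible (P : {poly int}) :
  (1 < size P)%N -> ~ irreducible_poly (polyQ P) ->
  exists f g : {poly int}, [/\ P = f * g, f != 0, g != 0 &
    (size f < size P)%N /\ (size g < size P)%N].
Proof.
move=> sP irr.
have P0 : P != 0 by rewrite -size_poly_gt0 ltnW.
have sQ : size (polyQ P) = size P by rewrite size_map_inj_poly//;
  exact: intr_inj.
have [q [q1 qP nq]] :
  exists q : {poly rat}, [/\ size q != 1%N, q %| polyQ P & ~ q %= polyQ P].
  apply: contrapT => H; apply: irr; split; first by rewrite sQ.
  by move=> q q1 qP; apply: contrapT => nq; apply: H; exists q.
have [f [a a0 qf] [g Pg]] := dvdpP_rat_int qP.
have sf : size q = size f.
  by rewrite qf size_scale// size_map_inj_poly//; exact: intr_inj.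
have f0 : f != 0 by apply: contra_neq P0 => f0; rewrite Pg f0 mul0r.
have g0 : g != 0 by apply: contra_neq P0 => g0; rewrite Pg g0 mulr0.
exists f, g; split => //.
have sPE : size P = (size f + size g).-1 by rewrite Pg size_mul.
have := dvdp_size_eqp qP; rewrite sf sQ => fP.
have /negP : ~ (size f == size P) by rewrite fP.
move: q1 (size_poly_gt0 f) (size_poly_gt0 g); rewrite f0 g0 sf sPE.
by move: (size f) (size g) => k l; lia.
Qed.

Lemma irreducible_zprimitive (P : {poly int}) : P != 0 ->
  irreducible_poly (polyQ P) -> irreducible_poly (polyQ (zprimitive P)).
Proof.
move=> P0 [s1 s2].
have cQ : (zcontents P)%:~R != 0 :> rat by rewrite intr_eq0 zcontents_eq0.
have e : polyQ P %= polyQ (zprimitive P).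
  by rewrite {1}(zpolyEprim P) /polyQ map_polyZ; apply: eqp_scale.
split; first by move: s1; rewrite (eqp_size e).
by move=> q q1; rewrite -(eqp_dvdr _ e) => qP; apply: eqp_trans e; exact: s2.
Qed.

(** Reducible polynomials are split, keeping a factor that vanishes at [alpha], until that factor is
    irreducible; its primitive part is the minimal polynomial. *)
Lemma minpoly_factor (R : realType) (alpha : R[i]) (P : {poly int}) :
  P != 0 -> root (map_poly intr P) alpha ->
  exists f g : {poly int}, is_minpolyZ alpha f /\ P = f * g.
Proof.
elim: (size P) {-2}P (leqnn (size P)) => [|k IHk] {}P.
  by rewrite leqn0 size_poly_eq0 => ->.
move=> Pk P0 rP.
have sP : (1 < size P)%N.
  rewrite ltnNge; apply/negP => /size1_polyC PC; move: rP P0.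
  rewrite PC map_polyC rootE hornerC intr_eq0 => /eqP ->.
  by rewrite eqxx.
have [irr|/int_reducible[]//] := pselect (irreducible_poly (polyQ P)).
  have c0 : zcontents P != 0 by rewrite zcontents_eq0.
  have PE := zpolyEprim P.
  exists (zprimitive P), (zcontents P)%:P; split; last first.
    by rewrite mulrC mul_polyC -PE.
  split; first by rewrite zcontents_primitive P0.
  - exact: irreducible_zprimitive.
  - by move: rP; rewrite {1}PE map_polyZ rootZ// intr_eq0.
move=> f [g [PE f0 g0 [sf sg]]].
move: rP; rewrite PE rmorphM rootM => /orP[rf|rg].
- have [|h [r [hm fE]]] := IHk f _ f0 rf; first by rewrite -ltnS;
    exact: leq_trans Pk.
  by exists h, (r * g); split => //; rewrite mulrA -fE.
- have [|h [r [hm gE]]] := IHk g _ g0 rg; first by rewrite -ltnS;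
    exact: leq_trans Pk.
  by exists h, (f * r); split => //; rewrite mulrCA -gE.
Qed.

(** * Derivatives at xi *)

Local Open Scope complex_scope.

(** This bounds the logarithmic derivative, a sum of the [1 / (x - a)], multiplied out so that no
    division by the value of the product occurs. *)
Lemma deriv_prod_XsubC_le (F : numFieldType) (s : seq F) (x rho : F) :
  0 < rho -> (forall a, a \in s -> rho <= `|x - a|) ->
  `|(\prod_(a <- s) ('X - a%:P))^`().[x]|
    <= (size s)%:R / rho * `|(\prod_(a <- s) ('X - a%:P)).[x]|.
Proof.
move=> r0; elim: s => [|a s IHs] sP.
  by rewrite !big_nil -polyC1 derivC horner0 normr0 !mul0r.
rewrite !big_cons derivM derivXsubC mul1r !hornerE.
set Q := (\prod_(b <- s) ('X - b%:P)) in IHs *.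
have {}IHs : `|Q^`().[x]| <= (size s)%:R / rho * `|Q.[x]|.
  by apply: IHs => b bs; apply: sP; rewrite inE bs orbT.
have ra : rho <= `|x - a| by apply: sP; rewrite inE eqxx.
apply: le_trans (ler_normD _ _) _; rewrite !normrM.
rewrite /= -addn1 natrD !mulrDl addrC; apply: lerD.
  by rewrite mulrCA; apply: ler_wpM2l.
by rewrite mul1r mulrA ler_peMl// mulrC ler_pdivlMr// mul1r.
Qed.

Lemma normcR (R : realType) (x : R) : `|x%:C| = `|x|%:C :> R[i].
Proof. by rewrite normc_def/= expr0n/= addr0 sqrtr_sqr. Qed.

Lemma ev_complex (R : realType) (xi : R) (p : {poly int}) :
  (map_poly intr p : {poly R[i]}).[xi%:C] = (ev xi p)%:C.
Proof.
rewrite /ev -horner_map/= -map_poly_comp/=; congr (_.[_]).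
by apply: eq_map_poly => m /=; rewrite rmorph_int.
Qed.

(** The transcendence of [xi] enters the argument through this nonvanishing. *)
Lemma ev_neq0 (R : realType) (xi : R) (p : {poly int}) :
  ~ algebraicOver (ratr : rat -> R) xi -> p != 0 -> ev xi p != 0.
Proof.
move=> xiT p0; apply: contra_notN xiT => ev0; exists (polyQ p).
  by rewrite -size_poly_gt0 size_map_inj_poly ?size_poly_gt0//; exact: intr_inj.
rewrite rootE /polyQ -map_poly_comp.
rewrite (_ : map_poly _ p = map_poly intr p)//.
by apply: eq_map_poly => m /=; rewrite ratr_int.
Qed.

Lemma finite_dist_lower_bound (R : realType) (xi : R) (s : seq R[i]) :
  exists2 rho : R, 0 < rho &
    forall a, a \in s -> 0 < `|xi%:C - a| -> rho%:C <= `|xi%:C - a|.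
Proof.
elim: s => [|a s [rho rho0 IHs]]; first by exists 1.
have [d0|d0] := boolP (0 < `|xi%:C - a|); last first.
  exists rho => // b; rewrite inE => /predU1P[->|]; last exact: IHs.
  by rewrite (negbTE d0).
move: d0; rewrite {1}normc_def; set d := Num.sqrt _.
rewrite -[0]/(0%:C) ltcR => d0.
exists (Num.min rho d); first by rewrite lt_min rho0.
move=> b; rewrite inE => /predU1P[-> _|bs b0].
  by rewrite normc_def -/d lecR ge_min lexx orbT.
by apply: le_trans (IHs b bs b0); rewrite lecR ge_min lexx.
Qed.

Lemma powR_ge1 (R : realType) (x r : R) : 1 <= x -> 0 <= r -> 1 <= x `^ r.
Proof.
move=> x1 r0; have <- : 1 `^ r = 1 :> R by rewrite powR1.
apply: ge0_ler_powR => //.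
  by rewrite nnegrE.
by rewrite nnegrE (le_trans ler01).
Qed.

(* [p' / p] at [xi] is the sum of [1 / (xi - alpha)] over the roots [alpha] of
   [p], and the minimal polynomial of a root divides [p]. *)
Lemma ev_deriv_le (R : realType) (xi w : R) (n : nat) :
  0 < w -> ~ algebraicOver (ratr : rat -> R) xi ->
  finite_set (approximants n xi w) ->
  exists2 C : R, 0 < C & forall p : {poly int}, p != 0 -> (size p <= n.+1)%N ->
    `|ev xi p^`()| <= C * `|ev xi p| * (naive_height p)%:R `^ (w + 1).
Proof.
move=> w0 xiT /finite_seqP[s sE].
have [rho rho0 Hrho] := finite_dist_lower_bound xi s.
have [K K1 HK] := @height_dvd_le R n.
have K0 : 0 < K := lt_le_trans ltr01 K1.
have w1 : 0 <= w + 1 by rewrite addr_ge0// ltW.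
(* The term [rho] serves the finitely many approximants; the other one absorbs the constant [K] by
   which the height of a divisor of [p] may exceed that of [p]. *)
pose c := Num.min rho (K `^ (w + 1))^-1.
have c0 : 0 < c by rewrite lt_min rho0 invr_gt0 powR_gt0.
exists (n.+1%:R / c); first by rewrite divr_gt0.
move=> p p0 sp; set H := (naive_height p)%:R.
have H1 : 1 <= H by exact: height_ge1.
have Hw1 : 1 <= H `^ (w + 1) by exact: powR_ge1.
have Hw0 : 0 < H `^ (w + 1) := lt_le_trans ltr01 Hw1.
pose r := c / H `^ (w + 1).
have r0 : 0 < r by rewrite divr_gt0.
have [t tE] := closed_field_poly_normal (map_poly intr p : {poly R[i]}).
have lc0 : lead_coef (map_poly intr p : {poly R[i]}) != 0.
  rewrite lead_coef_eq0 -size_poly_gt0 size_map_inj_poly ?size_poly_gt0//.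
  exact: intr_inj.
(* A root is either one of the finitely many approximants, or its minimal polynomial violates the
   approximation inequality; both cases keep it at distance at least [r]. *)
have tr a : a \in t -> r%:C <= `|xi%:C - a|.
  move=> at_; have rp : root (map_poly intr p) a.
    by rewrite tE rootZ// root_prod_XsubC.
  have d0 : 0 < `|xi%:C - a|.
    rewrite normr_gt0 subr_eq0; apply: contraTneq rp => <-.
    by rewrite rootE ev_complex fmorph_eq0 ev_neq0.
  have [as_|as_] := boolP (a \in s).
    apply: le_trans (Hrho a as_ d0); rewrite lecR /r ler_pdivrMr//.
    apply: le_trans (_ : rho <= _); first by rewrite ge_min lexx.
    by rewrite ler_peMr// ltW.
  have [f [g [fm pfg]]] := minpoly_factor p0 rp.
  have f0 : f != 0 by apply: contra_neq p0 => f0; rewrite pfg f0 mul0r.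
  have g0 : g != 0 by apply: contra_neq p0 => g0; rewrite pfg g0 mulr0.
  have Hf : (naive_height f)%:R <= K * H by rewrite /H pfg; apply: HK;
    rewrite -?pfg.
  have sf : (size f <= n.+1)%N.
    apply: leq_trans sp; rewrite pfg size_mul// -subn1 -addnBA ?leq_addr//.
    by rewrite size_poly_gt0.
  have nle : ~ (`|xi%:C - a| <= ((naive_height f)%:R `^ (- w - 1))%:C).
    move=> le1; move/negP: as_; apply.
    have : approximants n xi w a by exists f.
    by rewrite sE.
  move: nle; rewrite normc_def !lecR => /negP; rewrite -ltNge => /ltW;
    apply: le_trans.
  rewrite -opprD powRN /r ler_pdivrMr// mulrC ler_pdivlMr ?powR_gt0 ?ltr0n ?height_gt0//.
  apply: le_trans (_ : c * (K * H) `^ (w + 1) <= _).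
    apply: ler_wpM2l; first exact: ltW.
    by apply: ge0_ler_powR; rewrite ?nnegrE// mulr_ge0 ?(ltW K0).
  rewrite powRM ?(ltW K0)//.
  rewrite mulrA ler_piMl ?(ltW Hw0)//.
  rewrite -ler_pdivlMr ?powR_gt0// mul1r; by rewrite /c ge_min lexx orbT.
have r0C : 0 < r%:C by rewrite -[0]/(0%:C) ltcR.
have := deriv_prod_XsubC_le r0C tr.
rewrite -(ler_pM2l (_ : 0 < `|lead_coef (map_poly intr p : {poly R[i]})|)) ?normr_gt0//.
rewrite -normrM -hornerZ -derivZ -tE mulrCA -normrM -hornerZ -tE.
rewrite deriv_map !ev_complex !normcR => h.
rewrite -lecR; apply: le_trans h _.
have st : (size t <= n)%N.
  have : (size (map_poly intr p : {poly R[i]}) <= n.+1)%N.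
    exact: leq_trans (size_poly _ _) sp.
  by rewrite tE size_scale// size_prod_XsubC.
rewrite (_ : n.+1%:R / c * _ * _ = n.+1%:R / r * `|ev xi p|); last first.
  by rewrite /r invf_div; ring.
have cE (k : nat) (x : R) : (k%:R / r * x)%:C = k%:R / r%:C * x%:C :> R[i].
  by rewrite rmorphM rmorphM fmorphV rmorph_nat.
rewrite -cE lecR ler_wpM2r// ler_pM2r ?invr_gt0// ler_nat.
exact: leq_trans st _.
Qed.

(** * Nearly optimal irreducible polynomials *)

(** For transcendental [xi] the infimum of these [u] is Mahler's exponent $w_n(\xi)$. *)
Definition lower_exponent (R : realType) (xi : R) (n : nat) (u : R) : Prop :=
  exists2 c : R, 0 < c & forall p : {poly int}, p != 0 -> (size p <= n.+1)%N ->
    c <= `|ev xi p| * (naive_height p)%:R `^ u.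

Lemma ev_const_ge1 (R : realType) (xi : R) (p : {poly int}) :
  p != 0 -> (size p <= 1)%N -> 1 <= `|ev xi p|.
Proof.
move=> p0 /size1_polyC pE; rewrite pE /ev map_polyC hornerC normr_intr_ge1//.
by apply: contra_neq p0 => p0; rewrite pE p0.
Qed.

Lemma deriv_int_neq0 (p : {poly int}) : (1 < size p)%N -> p^`() != 0.
Proof.
move=> sp; apply/eqP => /polyP/(_ (size p).-2); rewrite coef_deriv coef0 =>
  /eqP.
rewrite mulrn_eq0/= prednK -?subn1 ?subn_gt0// subn1 -lead_coefE lead_coef_eq0.
by move=> /eqP p0; rewrite p0 size_poly0 in sp.
Qed.

Lemma height_deriv_le (R : realType) (n : nat) (p : {poly int}) :
  (size p <= n.+1)%N ->
  (naive_height p^`())%:R <= n.+1%:R * (naive_height p)%:R :> R.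
Proof.
move=> sp; apply: height_leR => [|i]; first by rewrite mulr_ge0.
rewrite coef_deriv; have [ip|ip] := ltnP i.+1 (size p); last first.
  by rewrite nth_default// mul0rn normr0 mulr_ge0.
rewrite -(mulr_natl p`_i.+1) intrM rmorph_nat normrM normr_nat;
  apply: ler_pM => //.
  by rewrite ler_nat (leq_trans (ltnW ip)).
exact: coefR_le_height.
Qed.

(** A lower bound for the derivative of [p] at [xi] gives one for [p], at the cost of [w + 1] in the
    exponent. Repeated differentiation ends at constants, whose values are nonzero integers. *)
Lemma lower_exponent_exists (R : realType) (xi w C : R) (n : nat) :
  0 < w -> 0 < C ->
  (forall p : {poly int}, p != 0 -> (size p <= n.+1)%N ->
    `|ev xi p^`()| <= C * `|ev xi p| * (naive_height p)%:R `^ (w + 1)) ->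
  exists u : R, lower_exponent xi n u.
Proof.
move=> w0 C0 L.
suff H k : exists u c : R, [/\ 0 <= u, 0 < c, c <= 1 & forall p : {poly int},
    p != 0 -> (size p <= n.+1)%N -> (size p <= k)%N ->
    c <= `|ev xi p| * (naive_height p)%:R `^ u].
  have [u [c [u0 c0 _ Hc]]] := H n.+1.
  by exists u, c => // p p0 sp; exact: Hc.
elim: k => [|k [u [c [u0 c0 c1 IHk]]]].
  exists 0, 1; split => // p p0 _; rewrite leqn0 size_poly_eq0.
  by rewrite (negbTE p0).
pose d : R := c / (C * n.+1%:R `^ u).
have nu0 : 0 < n.+1%:R `^ u :> R by rewrite powR_gt0.
have d0 : 0 < d by rewrite divr_gt0 ?mulr_gt0.
have uw : 0 <= u + (w + 1) by rewrite !addr_ge0// ltW.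
exists (u + (w + 1)), (Num.min 1 d); split => //.
- by rewrite lt_min ltr01.
- by rewrite ge_min lexx.
move=> p p0 sn sk.
have H1 : 1 <= (naive_height p)%:R :> R by exact: height_ge1.
have [s1|s1] := leqP (size p) 1.
  apply: le_trans (_ : 1 <= _); first by rewrite ge_min lexx.
  by rewrite -[leLHS]mulr1; apply: ler_pM => //;
    [exact: ev_const_ge1|exact: powR_ge1].
have p'0 := deriv_int_neq0 s1.
have sp' : (size p^`() < size p)%N := lt_size_deriv p0.
have := IHk p^`() p'0 (leq_trans (ltnW sp') sn).
have -> : (size p^`() <= k)%N by rewrite -ltnS; exact: leq_trans sk.
move=> /(_ isT) h1.
have h2 : (naive_height p^`())%:R `^ u <=
    n.+1%:R `^ u * (naive_height p)%:R `^ u :> R.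
  rewrite -powRM//; apply: ge0_ler_powR; rewrite ?nnegrE ?mulr_ge0//.
  exact: height_deriv_le.
have {}h1 : c <= C * `|ev xi p| * (naive_height p)%:R `^ (w + 1) *
    (n.+1%:R `^ u * (naive_height p)%:R `^ u).
  by apply: le_trans h1 _; apply: ler_pM => //; exact: L.
apply: le_trans (_ : d <= _); first by rewrite ge_min lexx orbT.
rewrite /d ler_pdivrMr ?mulr_gt0//; apply: le_trans h1 _.
rewrite (@powRD _ _ u (w + 1)); last by apply/implyP => _;
  rewrite gt_eqF // (lt_le_trans ltr01).
by rewrite le_eqVlt; apply/orP; left; apply/eqP; ring.
Qed.

Lemma lower_exponentW (R : realType) (xi u v : R) (n : nat) :
  u <= v -> lower_exponent xi n u -> lower_exponent xi n v.
Proof.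
move=> uv [c c0 H]; exists c => // p p0 sp; apply: le_trans (H p p0 sp) _.
by rewrite ler_wpM2l// ler_powR// height_ge1.
Qed.

Lemma lower_exponent_irr (R : realType) (xi u : R) (n : nat) (c : R) :
  0 <= u -> 0 < c ->
  (forall p : {poly int}, irreducible_poly (polyQ p) -> (size p <= n.+1)%N ->
    c <= `|ev xi p| * (naive_height p)%:R `^ u) ->
  lower_exponent xi n u.
Proof.
move=> u0 c0 H; have [K K0 HK] := @height_mul_le R n.
suff Hk k : exists2 d : R, 0 < d & forall p : {poly int},
    p != 0 -> (size p <= n.+1)%N -> (size p <= k)%N ->
    d <= `|ev xi p| * (naive_height p)%:R `^ u.
  by have [d d0 Hd] := Hk n.+1; exists d => // p p0 sp; exact: Hd.
elim: k => [|k [d d0 IHk]].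
  by exists 1 => // p p0 _; rewrite leqn0 size_poly_eq0 (negbTE p0).
have Ku : 0 < K `^ u by rewrite powR_gt0.
exists (Num.min 1 (Num.min c (d ^+ 2 / K `^ u))).
  by rewrite !lt_min ltr01 c0 divr_gt0// exprn_gt0.
move=> p p0 sn sk.
have H1 : 1 <= (naive_height p)%:R :> R by exact: height_ge1.
have [s1|s1] := leqP (size p) 1.
  apply: le_trans (_ : 1 <= _); first by rewrite ge_min lexx.
  by rewrite -[leLHS]mulr1; apply: ler_pM => //;
    [exact: ev_const_ge1|exact: powR_ge1].
have [irr|/int_reducible[]//] := pselect (irreducible_poly (polyQ p)).
  apply: le_trans (H p irr sn); by rewrite !ge_min lexx orbT.
move=> f [g [pE f0 g0 [sf sg]]].
apply: le_trans (_ : d ^+ 2 / K `^ u <= _); first by rewrite !ge_min lexx !orbT.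
rewrite ler_pdivrMr//.
have sfn : (size f <= n.+1)%N by exact: leq_trans (ltnW sf) sn.
have sgn : (size g <= n.+1)%N by exact: leq_trans (ltnW sg) sn.
have hf := IHk f f0 sfn (leq_trans sf sk : (size f <= k)%N).
have hg := IHk g g0 sgn (leq_trans sg sk : (size g <= k)%N).
apply: le_trans (_ : (`|ev xi f| * (naive_height f)%:R `^ u) *
    (`|ev xi g| * (naive_height g)%:R `^ u) <= _).
  by rewrite expr2; apply: ler_pM => //; exact: ltW.
rewrite mulrACA -normrM -evM -pE -powRM// -mulrA; apply: ler_wpM2l => //.
rewrite -powRM ?(ltW K0)//; apply: ge0_ler_powR;
  rewrite ?nnegrE ?mulr_ge0 ?(ltW K0)//.
by rewrite (mulrC _ K) pE; apply: HK.
Qed.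

(* Dirichlet's theorem, as the case [mu i = h + 1] of [prod_minima_le]. *)
Lemma lower_exponent1 (R : realType) (xi : R) (n : nat) :
  (2 <= n)%N -> ~ lower_exponent xi n 1.
Proof.
move=> n2 [c c0 H].
pose B : R := n.+1%:R * (1 + `|xi|) ^+ n.+1.
have B0 : 0 <= B by rewrite mulr_ge0// exprn_ge0// addr_ge0.
have key (h : nat) : (0 < h)%N ->
    (h%:R) ^+ n.+1 <= 4 ^+ n.+1 * (4 * B / c * h%:R ^+ 2 + 1) :> R.
  move=> h0; have h0R : 0 < h%:R :> R by rewrite ltr0n.
  (* With this [s], a nonzero [p] in the body would have value times height at most [c / 2]. Only
     [p = 0] remains, which lies in every span, and the [v j] can be taken to be 0. *)
  pose s := c / (2 * h%:R ^+ 2).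
  have s0 : 0 < s by rewrite divr_gt0// mulr_gt0// exprn_gt0.
  have := @prod_minima_le R xi B s n.+1 (fun=> 0) (fun=> h.+1) isT s0.
  rewrite prodr_const card_ord => P.
  apply: le_trans (_ : h.+1%:R ^+ n.+1 <= _).
    by rewrite lerXn2r ?nnegrE// ler_nat.
  apply: le_trans (P _ _ _ _) _ => //.
  - move=> p k sp pk; apply: ev_le => // i.
    by have := pk i; rewrite -intr_norm -(ler_int R).
  - move=> i k p iN kh sp pk evp.
    suff -> : p = 0 by rewrite /polyQ rmorph0; exact: spanned0.
    apply/eqP/negPn/negP => p0.
    have hk : (naive_height p)%:R <= h%:R :> R.
      rewrite ler_nat; apply: leq_trans (height_le pk) _; lia.
    have := H p p0 sp; rewrite powRr1// => le1.
    have : `|ev xi p| * (naive_height p)%:R <= s * h%:R * h%:R.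
      apply: ler_pM => //; apply: le_trans evp _.
      by rewrite ler_pM2l// ler_nat; lia.
    rewrite (_ : s * _ * _ = c / 2); last by rewrite /s; field; rewrite gt_eqF.
    by move: le1 c0; lra.
  - rewrite ler_pM2l ?exprn_gt0// lerD2r (_ : 2 * B / s = 4 * B / c * h%:R ^+ 2)//.
    by rewrite /s; field; rewrite !gt_eqF.
pose K : R := 4 ^+ n.+1 * (4 * B / c + 1).
have K0 : 0 < K.
  by rewrite mulr_gt0 ?exprn_gt0// ltr_wpDl// divr_ge0 ?mulr_ge0// ltW.
(* As [n] is at least 2, the left side of [key] grows at least like [h ^ 3] and the right side only
   like [h ^ 2]. *)
have hK (h : nat) : (0 < h)%N -> h%:R <= K.
  move=> h0; have h1 : 1 <= h%:R :> R by rewrite ler1n.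
  have h2 : 0 < h%:R ^+ 2 :> R by rewrite exprn_gt0// (lt_le_trans ltr01).
  rewrite -(ler_pM2r h2) -exprS; apply: le_trans (_ : h%:R ^+ n.+1 <= _).
    by rewrite ler_weXn2l.
  apply: le_trans (key h h0) _; rewrite /K -[leRHS]mulrA ler_pM2l ?exprn_gt0//.
  have h3 : 1 <= h%:R ^+ 2 :> R by rewrite exprn_ege1.
  by move: (4 * B / c) (h%:R ^+ 2 : R) h3 => x y; lra.
have := hK (Num.trunc K).+1 isT; apply/negP; rewrite -ltNge.
by have /andP[] := truncn_itv (ltW K0).
Qed.

(** Descending from some lower exponent in steps of [th] must stop, since none is below 1: some [u]
    is a lower exponent while [u - th] is not. By [lower_exponent_irr] this failure already shows on
    irreducible polynomials. *)
Lemma irreducible_near_optimal (R : realType) (xi w C th : R) (n : nat) :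
  (2 <= n)%N -> 0 < w -> 0 < C -> 0 < th <= 1 ->
  (forall p : {poly int}, p != 0 -> (size p <= n.+1)%N ->
    `|ev xi p^`()| <= C * `|ev xi p| * (naive_height p)%:R `^ (w + 1)) ->
  exists u : R, [/\ 1 <= u, lower_exponent xi n u &
    forall c, 0 < c -> exists P : {poly int},
      [/\ irreducible_poly (polyQ P), (size P <= n.+1)%N &
          `|ev xi P| * (naive_height P)%:R `^ (u - th) < c]].
Proof.
move=> n2 w0 C0 /andP[th0 th1] L.
have [u0 Eu0] := lower_exponent_exists w0 C0 L.
have gt1 u : lower_exponent xi n u -> 1 <= u.
  move=> Eu; rewrite leNgt; apply/negP => /ltW u1.
  exact: (@lower_exponent1 R xi n n2 (lower_exponentW u1 Eu)).
have [u [Eu nEu]] :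
  exists u, lower_exponent xi n u /\ ~ lower_exponent xi n (u - th).
  apply: contrapT => H.
  have step k : lower_exponent xi n (u0 - k%:R * th).
    elim: k => [|k IHk]; first by rewrite mul0r subr0.
    apply: contrapT => nE; apply: H; exists (u0 - k%:R * th); split => //.
    by rewrite -addrA -opprD -natr1 mulrDl mul1r in nE *.
  pose k := (Num.trunc (`|u0| / th)).+1.
  have := gt1 _ (step k).
  have /truncn_itv/andP[_] : 0 <= `|u0| / th by rewrite divr_ge0// ltW.
  rewrite -/k ltr_pdivrMr// => h1 h2.
  by have := ler_norm u0; lra.
have u1 := gt1 u Eu.
exists u; split => // c c0; apply: contrapT => H; apply: nEu.
apply: (lower_exponent_irr (c := c)) => //; first by lra.
move=> p irr sp; rewrite leNgt; apply/negP => lt1; apply: H.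
by exists p.
Qed.

(** * Successive minima *)

(** [S h p] stands for membership of [p] in the [h]-th dilate of a body. The prescribed [v0], [v1]
    share the value [mu0], below which the body holds only 0; each later polynomial is taken outside
    the current span with [h] least. *)
Lemma greedy_minima (S : nat -> {poly int} -> Prop) (N mu0 : nat)
    (v0 v1 : {poly int}) :
  (2 <= N)%N ->
  (forall p : {poly int}, (size p <= N)%N -> exists h, S h p) ->
  (forall h p, (h < mu0)%N -> S h p -> p = 0) ->
  indep 2 (fun t => polyQ (upd (fun=> v0) 1 v1 t)) ->
  exists (v : nat -> {poly int}) (mu : nat -> nat),
    [/\ v 0%N = v0 /\ v 1%N = v1, mu 0%N = mu0 /\ mu 1%N = mu0,
        indep N (fun t => polyQ (v t)),
        forall j, (1 < j < N)%N -> S (mu j) (v j) &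
        (forall i j, (i <= j < N)%N -> (mu i <= mu j)%N) /\
        forall i h p, (i < N)%N -> (h < mu i)%N -> S h p ->
          spanned i (fun t => polyQ (v t)) (polyQ p)].
Proof.
move=> N2 Sall S0 i2.
suff H k : (k <= N)%N -> (2 <= k)%N ->
  exists (v : nat -> {poly int}) (mu : nat -> nat),
    [/\ v 0%N = v0 /\ v 1%N = v1, mu 0%N = mu0 /\ mu 1%N = mu0,
        indep k (fun t => polyQ (v t)),
        forall j, (1 < j < k)%N -> S (mu j) (v j) &
        (forall i j, (i <= j < k)%N -> (mu i <= mu j)%N) /\
        forall i h p, (i < k)%N -> (h < mu i)%N -> S h p ->
          spanned i (fun t => polyQ (v t)) (polyQ p)].
  exact: H.
elim: k => [//|k IHk] kN; rewrite leq_eqVlt => /predU1P[<-|k2].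
  exists (upd (fun=> v0) 1 v1), (fun=> mu0); split => //; first by move=> j;
    lia.
  split => // i h p _ hmu /(S0 _ _ hmu) ->; rewrite /polyQ rmorph0.
  exact: spanned0.
have [v [mu [vE muE iv Sv [mumono muspan]]]] := IHk (ltnW kN) k2.
set u := (fun t => polyQ (v t)) in iv muspan.
have ex : exists h, `[< exists p, S h p /\ ~ spanned k u (polyQ p) >].
  apply: contrapT => H.
  suff : (N <= k)%N by rewrite leqNgt kN.
  apply: (indep_leq (@indepXn rat N) (u := u)) => t tN.
  have [h Sh] : exists h, S h 'X^t by apply: Sall; rewrite size_polyXn.
  apply: contrapT => nt; apply: H; exists h; apply/asboolP; exists 'X^t.
  by rewrite /polyQ map_polyXn.
have [h /asboolP[p [Sp np]] hmin] := ex_minnP ex.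
have hspan h' q : (h' < h)%N -> S h' q -> spanned k u (polyQ q).
  move=> h'h Sq; apply: contrapT => nq.
  have : (h <= h')%N by apply: hmin; apply/asboolP; exists q.
  by rewrite leqNgt h'h.
have uE t : (t < k)%N -> u t = polyQ (upd v k p t) by rewrite /u /upd => ->.
exists (upd v k p), (upd mu k h); split.
- by rewrite /upd (_ : (1 < k)%N) ?(ltnW (_ : (1 < k)%N)).
- by rewrite /upd (_ : (1 < k)%N) ?(ltnW (_ : (1 < k)%N)).
- apply: eq_indep (indep_upd iv np) => t _; rewrite /upd /u; by case: ifP.
- move=> j /andP[j1]; rewrite ltnS leq_eqVlt => /predU1P[->|jk].
    by rewrite /upd ltnn.
  by rewrite /upd jk; apply: Sv; rewrite j1.
- split.
  + move=> i j /andP[ij]; rewrite ltnS leq_eqVlt => /predU1P[jk|jk]; last first.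
      by rewrite /upd jk (leq_ltn_trans ij jk); apply: mumono; rewrite ij.
    rewrite jk {2}/upd ltnn /upd; case: ifP => // ik.
    rewrite leqNgt; apply/negP => hmu; apply: np.
    exact: spannedW (ltnW ik) (muspan i h p ik hmu Sp).
  + move=> i h' q; rewrite ltnS leq_eqVlt => /predU1P[->|ik].
      by rewrite {1}/upd ltnn => h'h /(hspan _ _ h'h); exact: eq_spanned.
    rewrite {1}/upd ik => h'mu /(muspan i h' q ik h'mu).
    by apply: eq_spanned => t ti; apply: uE; exact: ltn_trans ti ik.
Qed.

(** The change of family is unitriangular: [t 0%N = 0] leaves the first vector fixed. *)
Lemma indep_shear (F : fieldType) (V : lmodType F) (N : nat) (u : nat -> V)
    (t : nat -> F) :
  t 0%N = 0 -> indep N u -> indep N (fun j => u j - t j *: u 0%N).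
Proof.
case: N => [|N] t0 iu c H; first by [].
pose S := \sum_(j < N.+1) c j * t j.
pose d j := c j - (if j == 0%N then S else 0).
have d0 : forall j, (j < N.+1)%N -> d j = 0.
  apply: iu; rewrite -[RHS]H.
  under eq_bigr do rewrite /d scalerBl.
  rewrite [RHS](eq_bigr (fun j : 'I_N.+1 =>
    c j *: u j - (c j * t j) *: u 0%N)); last first.
    by move=> j _; rewrite scalerBr scalerA.
  rewrite !sumrB -scaler_suml -/S; congr (_ - _).
  rewrite big_ord_recl/= big1 ?addr0// => j _; by rewrite scale0r.
have cS j : (0 < j < N.+1)%N -> c j = 0.
  by case: j => // j /d0; rewrite /d subr0.
have S0 : S = 0.
  rewrite /S big_ord_recl t0 mulr0 add0r big1// => j _.
  by rewrite cS ?mul0r// lift0 !ltnS ltn_ord.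
case=> [_|j jN]; last exact: cS.
by have := d0 0%N isT; rewrite /d S0 subr0.
Qed.

(** * Tools for the two starting polynomials *)

Lemma height_mul_XsubC (n c e : nat) (p : {poly int}) : (c <= n)%N ->
  (naive_height (p * ('X - c%:Z%:P) ^+ e) <= n.+1 ^ e * naive_height p)%N.
Proof.
move=> cn; elim: e p => [|e IHe] p; first by rewrite expr0 mulr1 mul1n.
rewrite exprS mulrA; apply: leq_trans (IHe _) _.
rewrite expnSr -mulnA leq_mul2l; apply/orP; right; apply: height_le => i.
rewrite mulrBr coefB coefMX coefMC.
have h1 : `|if i == 0%N then 0 else p`_i.-1| <= (naive_height p)%:Z.
  by case: ifP => _; [rewrite normr0|exact: coef_le_height].
have h2 : `|p`_i * c%:Z| <= (naive_height p)%:Z * n%:Z.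
  by rewrite normrM; apply: ler_pM => //; exact: coef_le_height.
apply: le_trans (ler_normB _ _) _.
by rewrite PoszM -addn1 PoszD mulrDl mul1r addrC (mulrC n%:Z); exact: lerD.
Qed.

Lemma ev_XsubC_exp_le (R : realType) (xi : R) (n c e : nat) :
  (c <= n)%N -> (e <= n)%N ->
  `|ev xi (('X - c%:Z%:P) ^+ e)| <= (`|xi| + n.+1%:R) ^+ n.
Proof.
move=> cn en; rewrite /ev rmorphXn/= horner_exp normrX.
rewrite rmorphB/= map_polyX map_polyC hornerXsubC.
have b1 : 1 <= `|xi| + n.+1%:R by rewrite -[leLHS]add0r lerD// ler1n.
apply: le_trans (_ : (`|xi| + n.+1%:R) ^+ e <= _); last by rewrite ler_weXn2l.
rewrite lerXn2r ?nnegrE ?addr_ge0//; apply: le_trans (ler_normB _ _) _.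
by rewrite lerD2l normr_nat ler_nat ltnW.
Qed.

(** Used to find a small [c] with ['X - c] coprime to the best approximation [v0]. *)
Lemma exists_nonroot (n : nat) (p : {poly int}) :
  p != 0 -> (size p <= n.+1)%N -> exists2 c : nat, (c <= n)%N & ~~ root p c%:Z.
Proof.
move=> p0 sp; apply: contrapT => H.
have : (size (map Posz (iota 0 n.+1)) < size p)%N.
  apply: max_poly_roots => //.
    apply/allP => x /mapP[c]; rewrite mem_iota => cn ->; apply/negPn/negP => nr.
    by apply: H; exists c => //; lia.
  by rewrite map_inj_uniq ?iota_uniq// => x y [].
by rewrite size_map size_iota ltnNge sp.
Qed.

(** Irreducibility makes [P] divide [q] over the rationals, and primitivity makes the cofactor
    integral; a comparison of heights can then exclude the divisibility. *)
Lemma irreducible_coprime_height (P q : {poly int}) :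
  irreducible_poly (polyQ P) -> zprimitive P = P ->
  ~ coprimep (polyQ q) (polyQ P) -> exists r, q = P * r.
Proof.
move=> [sP irr] prim nc.
have e : gcdp (polyQ q) (polyQ P) %= polyQ P.
  by apply: irr; [apply/negP => /nc|exact: dvdp_gcdr].
have : polyQ P %| polyQ q by rewrite -(eqp_dvdl _ e); exact: dvdp_gcdl.
rewrite dvdp_rat_int => /dvdpP_int[r ->].
by exists r; rewrite prim.
Qed.

(** An infimum with a loss of a factor 2 replaces the minimum; the bound [m] makes the infimum
    positive. *)
Lemma near_minimal_value (R : realType) (xi m : R) (n h : nat) :
  (0 < h)%N -> 0 < m ->
  (forall p : {poly int}, p != 0 -> (size p <= n.+1)%N ->
     (naive_height p <= h)%N -> m <= `|ev xi p|) ->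
  exists v0 : {poly int}, [/\ v0 != 0, (size v0 <= n.+1)%N,
    (naive_height v0 <= h)%N & forall p : {poly int}, p != 0 ->
      (size p <= n.+1)%N -> (naive_height p <= h)%N ->
      `|ev xi v0| < 2 * `|ev xi p|].
Proof.
move=> h0 m0 H.
pose A : set R := [set y | exists p : {poly int},
  [/\ p != 0, (size p <= n.+1)%N, (naive_height p <= h)%N & `|ev xi p| = y]]%classic.
have A1 : A `|ev xi 1|.
  exists 1; split => //; first exact: oner_neq0; first by rewrite size_poly1.
  apply: height_le => i; rewrite coef1; case: (i == 0%N);
    rewrite ?normr1 ?normr0//.
have Am : lbound A m by move=> _ [p [p0 sp hp <-]]; exact: H.
have infA : has_inf A by split; [by exists `|ev xi 1| | by exists m].
have im : m <= inf A by apply: lb_le_inf; [by exists `|ev xi 1| | ].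
have i0 : 0 < inf A := lt_le_trans m0 im.
have [_ [v0 [v00 sv hv <-]] lt0] := inf_adherent i0 infA.
exists v0; split => // p p0 sp hp; apply: lt_le_trans lt0 _.
have : inf A <= `|ev xi p| by apply: ge_inf; [exists m|exists p].
by lra.
Qed.

Lemma zprimitive_le (R : realType) (xi : R) (P : {poly int}) : P != 0 ->
  `|ev xi (zprimitive P)| <= `|ev xi P| /\
  (naive_height (zprimitive P) <= naive_height P)%N.
Proof.
move=> P0; have c0 : zcontents P != 0 by rewrite zcontents_eq0.
have PE := zpolyEprim P; split.
  rewrite {2}PE evZ normrM ler_peMl// normr_intr_ge1//.
apply: height_le => i; apply: le_trans (coef_le_height P i).
rewrite {2}PE coefZ normrM ler_peMl//; lia.
Qed.

(* In the notation of the statement [delta = T ^ (- x)] and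
   [eta k.-1 = T ^ a_k], up to factors [T ^ eps] and constants. *)
Definition good_system (R : realType) (xi : R) (n T : nat) (delta : R)
    (v : nat -> {poly int}) (eta : nat -> nat) : Prop :=
  [/\ eta 0%N = T /\ eta 1%N = T,
      forall i j, (i <= j < n.+1)%N -> (eta i <= eta j)%N,
      forall j, (j < n.+1)%N ->
        [/\ (size (v j) <= n.+1)%N,
            forall i, `|((v j)`_i)%:~R| <= 3 * (eta j)%:R :> R &
            `|ev xi (v j)| <= delta],
      size (v 1%N) = n.+1 /\ coprimep (polyQ (v 0%N)) (polyQ (v 1%N)) &
      indep n.+1 (fun t => polyQ (v t))].

Lemma good_system_exists (R : realType) (xi w C th : R) (n : nat) :
  (2 <= n)%N -> 0 < w -> 0 < C -> 0 < th <= 1 ->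
  ~ algebraicOver (ratr : rat -> R) xi ->
  (forall p : {poly int}, p != 0 -> (size p <= n.+1)%N ->
    `|ev xi p^`()| <= C * `|ev xi p| * (naive_height p)%:R `^ (w + 1)) ->
  exists2 K1 : R, 0 < K1 & forall T0 : R, exists T delta v eta,
    [/\ T0 <= T%:R /\ (1 < T)%N, 0 < delta, good_system xi n T delta v eta &
        \prod_(i < n) (eta i.+1)%:R <= K1 * (T%:R `^ th) ^+ n.+1 / delta].
Proof.
move=> n2 w0 C0 th01 xiT L; have /andP[th0 th1] := th01.
have [u [u1 [cu cu0 Hcu] HP]] := irreducible_near_optimal n2 w0 C0 th01 L.
have [K K1 HK] := @height_dvd_le R n.
(* The power of [n.+1] pays for multiplying [P] by powers of ['X - c]; the factor 2 gives
   [2 * T' <= T]. *)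
pose C1 : nat := (2 * n.+1 ^ n)%N.
have C1_gt0 : (0 < C1)%N by rewrite muln_gt0 expn_gt0.
pose V : R := (`|xi| + n.+1%:R) ^+ n.
have V0 : 0 < V by rewrite exprn_gt0// ltr_wpDl.
pose B : R := n.+1%:R * (1 + `|xi|) ^+ n.+1.
have B0 : 0 <= B by rewrite mulr_ge0// exprn_ge0// addr_ge0.
exists ((4 * C1%:R) ^+ n.+1 * (2 * B + 2)).
  by rewrite mulr_gt0 ?exprn_gt0 ?mulr_gt0 ?ltr0n// ltr_wpDl// mulr_ge0.
move=> T0.
pose Y : R := Num.max K (Num.max T0 1).
have Y0 : 0 < Y by rewrite !lt_max ltr01 !orbT.
pose c := Num.min (cu / V) (cu / Y).
have c0 : 0 < c by rewrite lt_min !divr_gt0.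
have [P [Pirr Psize Pprim Pc]] : exists P : {poly int},
    [/\ irreducible_poly (polyQ P), (size P <= n.+1)%N, zprimitive P = P &
        `|ev xi P| * (naive_height P)%:R `^ (u - th) < c].
  have [P [irr sP Pc]] := HP c c0.
  have P0 : P != 0.
    by apply/eqP => P0; case: irr; rewrite P0 /polyQ rmorph0 size_poly0.
  have [le1 le2] := @zprimitive_le R xi P P0.
  exists (zprimitive P); split.
  - exact: irreducible_zprimitive.
  - by rewrite size_zprimitive.
  - exact: zprimitive_id.
  - apply: le_lt_trans Pc; apply: ler_pM => //.
    apply: ge0_ler_powR; rewrite ?nnegrE ?ler_nat//.
    by rewrite subr_ge0; exact: le_trans th1 u1.
have sP1 : (1 < size P)%N.
  by have [] := Pirr; rewrite size_map_inj_poly//; exact: intr_inj.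
have P0 : P != 0 by rewrite -size_poly_gt0 ltnW.
set H := (naive_height P)%:R : R.
have H1 : 1 <= H by exact: height_ge1.
have H0 : 0 < H := lt_le_trans ltr01 H1.
have HYth : Y < H `^ th.
  have := Hcu P P0 Psize; rewrite -[u in _ `^ u](subrK th).
  rewrite powRD; last by apply/implyP => _; rewrite gt_eqF.
  rewrite mulrA => le1.
  have := le_lt_trans le1 _ => /(_ (c * H `^ th)).
  rewrite ltr_pM2r ?powR_gt0// => /(_ Pc) lt1.
  have : cu < cu / Y * H `^ th.
    apply: lt_le_trans lt1 _; rewrite ler_pM2r ?powR_gt0//.
    by rewrite ge_min lexx orbT.
  by rewrite -mulrA ltr_pMr// mulrC ltr_pdivlMr// mul1r.
have Hth1 : 1 <= H `^ th by exact: powR_ge1 (ltW th0).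
have HthH : H `^ th <= H.
  by rewrite -[leRHS]powRr1 ?(ltW H0)// ler_powR.
pose T := (C1 * naive_height P)%N.
have HT : H <= T%:R by rewrite /H /T ler_nat leq_pmull.
pose T' := Num.trunc (H `^ (1 - th)).
have H1th : 1 <= H `^ (1 - th) by apply: powR_ge1 => //; lra.
have /andP[T'le T'gt] := truncn_itv (le_trans ler01 H1th).
have T'1 : (0 < T')%N by rewrite truncn_gt0.
have Hsplit : H `^ th * H `^ (1 - th) = H.
  rewrite -powRD; last by apply/implyP => _; rewrite gt_eqF.
  by rewrite addrC subrK powRr1// ltW.
have T'H : (T' <= naive_height P)%N.
  rewrite -(ler_nat R); apply: le_trans T'le _; rewrite -/H -[leRHS]Hsplit.
  by rewrite ler_peMl// ltW// (lt_le_trans ltr01).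
have T'T : (2 * T' <= T)%N.
  by rewrite /T /C1 -mulnA leq_pmul2l// (leq_trans T'H)// leq_pmull// expn_gt0.
have u0 : 0 <= u := le_trans ler01 u1.
have T'R : 0 < T'%:R :> R by rewrite ltr0n.
have T'u : 0 < T'%:R `^ u by rewrite powR_gt0.
have [||v0 [v00 sv0 hv0 v0min]] :=
    @near_minimal_value R xi (cu / T'%:R `^ u) n T' T'1.
- by rewrite divr_gt0.
- move=> p p0 sp hp; rewrite ler_pdivrMr//; apply: le_trans (Hcu p p0 sp) _.
  rewrite ler_wpM2l//; apply: ge0_ler_powR; by rewrite ?nnegrE ?ler_nat.
set delta := `|ev xi v0| in v0min.
have d0 : 0 < delta by rewrite normr_gt0 ev_neq0.
have d2 : delta <= 2.
  have h1 : (naive_height 1 <= T')%N.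
    apply: leq_trans T'1; apply: height_le => i; rewrite coef1.
    by case: (i == 0%N); rewrite ?normr1 ?normr0.
  have := v0min 1 (oner_neq0 _); rewrite size_poly1 => /(_ isT h1).
  by rewrite /ev rmorph1 hornerC normr1 mulr1 => /ltW.
have dge : cu / T'%:R `^ u <= delta.
  rewrite ler_pdivrMr//; apply: le_trans (Hcu v0 v00 sv0) _.
  rewrite ler_wpM2l//; apply: ge0_ler_powR; by rewrite ?nnegrE ?ler_nat.
have [c' c'n c'root] := exists_nonroot v00 sv0.
pose e := (n.+1 - size P)%N.
pose v1 := P * ('X - c'%:Z%:P) ^+ e.
have en : (e <= n)%N by rewrite /e leq_subLR -add1n leq_add2r ltnW.
have sv1 : size v1 = n.+1.
  rewrite /v1 size_Mmonic ?monic_exp ?monicXsubC//.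
  by rewrite size_exp_XsubC addnS/= /e subnKC.
have hv1 : (naive_height v1 <= T)%N.
  apply: leq_trans (height_mul_XsubC _ _ c'n) _.
  rewrite /T leq_mul2r; apply/orP; right; rewrite /C1.
  apply: (@leq_trans (n.+1 ^ n)); last by rewrite leq_pmull.
  by rewrite leq_exp2l// ltnS ltnW.
(* Since [u >= 1], [T' ^ u <= H ^ ((1 - th) * u) <= H ^ (u - th)]: the small value of [P] beats the
   lower bound for all polynomials of height at most [T']. *)
have ev1 : `|ev xi v1| <= delta.
  apply: le_trans dge.
  have T'uH : T'%:R `^ u <= H `^ (u - th).
    apply: le_trans (_ : (H `^ (1 - th)) `^ u <= _).
      by apply: ge0_ler_powR; rewrite ?nnegrE ?powR_ge0.
    rewrite -powRrM ler_powR//; have := ler_peMr (ltW th0) u1; lra.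
  rewrite /v1 evM normrM; apply: le_trans (_ : cu / H `^ (u - th) <= _);
    last first.
    by rewrite ler_pM2l// lef_pV2 ?posrE ?powR_gt0.
  rewrite ler_pdivlMr ?powR_gt0//.
  apply: le_trans (_ : `|ev xi P| * V * H `^ (u - th) <= _).
    by rewrite ler_wpM2r ?powR_ge0// ler_wpM2l// ev_XsubC_exp_le.
  rewrite mulrAC; apply: le_trans (_ : c * V <= _).
    by rewrite ler_pM2r// ltW.
  by rewrite -ler_pdivlMr// ge_min lexx.
(* If [P] divided [v0], then [H <= K * H ^ (1 - th) < H]. *)
have cop : coprimep (polyQ v0) (polyQ v1).
  rewrite /v1 /polyQ rmorphM coprimepMr; apply/andP; split; last first.
    rewrite rmorphXn rmorphB/= map_polyX map_polyC; apply: coprimep_expr.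
    by rewrite coprimep_XsubC rootE horner_map intr_eq0.
  apply/negPn/negP => /negP /(irreducible_coprime_height Pirr Pprim)[r v0E].
  have r0 : r != 0 by apply: contra_neq v00 => r0; rewrite v0E r0 mulr0.
  have := HK P r P0 r0; rewrite -v0E => /(_ sv0); rewrite -/H => le1.
  have le2 : H <= K * H `^ (1 - th).
    apply: le_trans le1 _; rewrite ler_wpM2l ?(le_trans ler01)//.
    by apply: le_trans T'le; rewrite ler_nat.
  have : H < H.
    apply: le_lt_trans le2 _; rewrite -[ltRHS]Hsplit ltr_pM2r ?powR_gt0//.
    by apply: le_lt_trans HYth; rewrite le_max lexx.
  by rewrite ltxx.
have i2 : indep 2 (fun t => polyQ (upd (fun=> v0) 1 v1 t)).
  apply: indep_recr.
    move=> a; rewrite big_ord1 /upd/= => /eqP; rewrite scaler_eq0.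
    rewrite -size_poly_eq0 size_map_inj_poly ?size_poly_eq0 ?(negbTE v00) ?orbF//; last exact: intr_inj.
    by move=> /eqP a0 [].
  move=> [a]; rewrite big_ord1 /upd/= => v1E.
  have : polyQ v1 %| polyQ v0.
    have a0 : a 0%N != 0.
      apply/eqP => a0; have := sv1;
        rewrite -(size_map_inj_poly (@intr_inj rat))//.
      by rewrite -/(polyQ v1) v1E a0 scale0r size_poly0.
    by rewrite v1E dvdpZl ?dvdpp.
  move=> /coprimep_dvdr /(_ cop).
  rewrite coprimepp size_map_inj_poly//; last exact: intr_inj.
  by rewrite sv1 => /eqP[n0]; move: n2; rewrite n0.
have TR : 0 < T%:R :> R by rewrite (lt_le_trans H0).
(* At scale [T] the body allows values up to [delta]. At scale [T'] it allows at most [delta / 2],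
   so near-minimality of [v0] leaves only 0. *)
pose s := delta / T%:R.
have s0 : 0 < s by rewrite divr_gt0.
pose S (h : nat) (p : {poly int}) := [/\ (size p <= n.+1)%N,
  forall i, `|p`_i| <= h%:Z & `|ev xi p| <= s * h%:R].
have [||||v [mu [[vE0 vE1] [muE0 muE1] iv Sv [mumono muspan]]]] :=
    @greedy_minima S n.+1 T'.+1 v0 v1.
- exact: leq_trans n2 _.
- move=> p sp; pose k := (Num.trunc (`|ev xi p| / s)).+1.
  exists (naive_height p + k)%N; split => //.
    by move=> i; apply: le_trans (coef_le_height p i) _;
      rewrite lez_nat leq_addr.
  have /truncn_itv/andP[_ /ltW] : 0 <= `|ev xi p| / s by rewrite divr_ge0// ltW.
  rewrite -/k ler_pdivrMr// mulrC => le1; apply: le_trans le1 _.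
  by rewrite ler_pM2l// ler_nat leq_addl.
- move=> h p; rewrite ltnS => hT' [sp ph evp]; apply/eqP/negPn/negP => p0.
  have := v0min p p0 sp (leq_trans (height_le ph) hT').
  apply/negP; rewrite -leNgt.
  apply: le_trans (_ : 2 * (s * T'%:R) <= _).
    by rewrite ler_pM2l//; apply: le_trans evp _; rewrite ler_pM2l// ler_nat.
  rewrite /s mulrAC mulrA ler_pdivrMr// mulrCA ler_pM2l//.
  by rewrite -natrM ler_nat.
- exact: i2.
have sv j : (j < n.+1)%N -> (size (v j) <= n.+1)%N.
  case: j => [|[|j]] jn; first by rewrite vE0.
    by rewrite vE1 sv1.
  by have [] := Sv j.+2 jn.
have mu0 i : (i < n.+1)%N -> (T' < mu i)%N.
  by move=> iN; rewrite -muE0; apply: mumono.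
have Pmu : \prod_(i < n.+1) (mu i)%:R <= 4 ^+ n.+1 * (2 * B / s + 1).
  apply: (@prod_minima_le R xi B s n.+1 v mu) => //.
  - move=> p k sp pk; apply: ev_le => // i.
    by have := pk i; rewrite -intr_norm -(ler_int R).
  - by move=> i /mu0; apply: leq_trans; rewrite ltnS.
  - by move=> i h p iN hmu sp ph evp; apply: (muspan i h p).
pose eta i := maxn T (mu i).
have TT' : (T'.+1 <= T)%N.
  by apply: leq_trans T'T; rewrite mul2n -addnn -addn1 leq_add2l.
(* Subtracting [t j] times [v0] brings the value at [xi] down to at most [delta]. The multiplier is
   at most [eta j / T + 1], so the coefficients stay below [3 * eta j]; for [j < 2] nothing
   changes. *)
pose t (j : nat) : int :=
  if (j < 2)%N then 0 else Num.floor (ev xi (v j) / ev xi v0).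
pose v' j := v j - t j *: v0.
have muT j : (mu j <= eta j)%N by exact: leq_maxr.
have Teta j : (T <= eta j)%N by exact: leq_maxl.
have etaE0 : eta 0%N = T by rewrite /eta muE0; exact/maxn_idPl.
have etaE1 : eta 1%N = T by rewrite /eta muE1; exact/maxn_idPl.
have v'E j : (j < 2)%N -> v' j = v j.
  by move=> j2; rewrite /v' /t j2 scale0r subr0.
have Hv0 i : `|(v0`_i)%:~R| <= T%:R :> R.
  apply: le_trans (@coefR_le_height R _ _) _; rewrite ler_nat.
  by apply: leq_trans hv0 _; exact: ltnW.
exists T, delta, v', eta; split => //.
- split; last by apply: leq_trans TT'.
  apply: le_trans HT; apply: le_trans HthH; apply: le_trans (ltW HYth).
  by rewrite !le_max lexx orbT.
- split => //.
  + move=> i j ij; rewrite /eta geq_max leq_maxl/=.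
    by apply: leq_trans (leq_maxr _ _); exact: mumono.
  + move=> j jn; have [j2|j2] := ltnP j 2.
      rewrite v'E//; split; first exact: sv.
        move=> i; apply: le_trans (_ : T%:R <= _); last first.
          by rewrite -[leLHS]mul1r; apply: ler_pM; rewrite ?ler_nat ?ler1n.
        case: j j2 {jn} => [|[|//]] _; first by rewrite vE0; exact: Hv0.
        rewrite vE1; apply: le_trans (@coefR_le_height R _ _) _.
        by rewrite ler_nat.
      by case: j j2 {jn} => [|[|//]] _; rewrite ?vE0 ?vE1.
    have [svj hvj evj] : S (mu j) (v j) by apply: Sv; rewrite j2.
    have tE : t j = Num.floor (ev xi (v j) / ev xi v0).
      by rewrite /t ltnNge j2.
    have ev00 : ev xi v0 != 0 by rewrite -normr_gt0.
    have /andP[fl1 fl2] := floor_itv (ev xi (v j) / ev xi v0).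
    rewrite -tE intrD in fl1 fl2.
    split.
    * apply: leq_trans (size_polyD _ _) _; rewrite geq_max svj size_polyN.
      exact: leq_trans (size_scale_leq _ _) sv0.
    * move=> i; rewrite coefB coefZ intrB intrM.
      have h1 : `|((v j)`_i)%:~R| <= (eta j)%:R :> R.
        have := hvj i; rewrite -(ler_int R) intr_norm => h; apply: le_trans h _.
        by rewrite ler_nat.
      have h2 : `|(t j)%:~R| <= (eta j)%:R / T%:R + 1 :> R.
        have h3 : `|ev xi (v j) / ev xi v0| <= (eta j)%:R / T%:R.
          rewrite normrM normfV ler_pdivrMr// (le_trans evj)// /s.
          rewrite [leLHS](_ : _ = (mu j)%:R / T%:R * delta); last by ring.
          by rewrite ler_pM2r// ler_pM2r ?invr_gt0// ler_nat.
        move: h3; rewrite !ler_norml => /andP[h3 h4]; apply/andP.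
        by move: fl1 fl2 h3 h4; clear; lra.
      apply: le_trans (ler_normB _ _) _; rewrite normrM.
      apply: le_trans (_ : (eta j)%:R + ((eta j)%:R / T%:R + 1) * T%:R <= _).
        by rewrite lerD// ler_pM.
      rewrite mulrDl mul1r divfK ?gt_eqF//.
      have : T%:R <= (eta j)%:R :> R by rewrite ler_nat.
      by clear; lra.
    * rewrite /v' evB evZ.
      rewrite (_ : _ - _ = ev xi v0 * (ev xi (v j) / ev xi v0 - (t j)%:~R));
        last first.
        by field.
      rewrite normrM ler_piMr// ler_norml.
      by apply/andP; move: fl1 fl2; clear; lra.
  + by rewrite !v'E// vE0 vE1.
  + have : t 0%N = 0 by [].
    move=> t00; have tR0 : (t 0%N)%:~R = 0 :> rat by rewrite t00.
    apply: eq_indep (indep_shear (t := fun j => (t j)%:~R) tR0 iv) => j _.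
    by rewrite vE0 /v' /polyQ rmorphB/= map_polyZ.
(* Raising [mu i] to at least [T] costs little: [T = C1 * H ^ th * H ^ (1 - th)], and the last
   factor is below [T'.+1 <= mu i]. *)
- have eta_le i : (i < n.+1)%N -> (eta i)%:R <= C1%:R * T%:R `^ th * (mu i)%:R :> R.
    move=> iN; have a1 : 1 <= C1%:R * T%:R `^ th :> R.
      rewrite -[leLHS]mulr1; apply: ler_pM => //; first by rewrite ler1n.
      by apply: powR_ge1; [exact: le_trans HT|exact: ltW].
    rewrite /eta natr_max ge_max; apply/andP; split; last by rewrite ler_peMl.
    rewrite [leLHS]natrM -[leRHS]mulrA ler_pM2l ?ltr0n// -/H -[leLHS]Hsplit.
    apply: ler_pM; rewrite ?powR_ge0//.
      by apply: ge0_ler_powR; rewrite ?nnegrE ?(ltW th0) ?(ltW H0).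
    by apply: le_trans (ltW T'gt) _; rewrite ler_nat; exact: mu0.
  have Peta : \prod_(i < n.+1) (eta i)%:R <=
      (C1%:R * T%:R `^ th) ^+ n.+1 * (4 ^+ n.+1 * (2 * B / s + 1)).
    apply: le_trans (_ : \prod_(i < n.+1) (C1%:R * T%:R `^ th * (mu i)%:R) <= _).
      by apply: ler_prod => i _; rewrite ler0n/= eta_le.
    by rewrite big_split/= prodr_const card_ord; apply: ler_wpM2l => //.
  move: Peta; rewrite big_ord_recl etaE0 mulrC -ler_pdivlMr// => Peta.
  apply: le_trans Peta _; rewrite ler_pdivrMr//.
  set X := (T%:R `^ th); rewrite !exprMn.
  have le1 : 2 * B / s + 1 <= (2 * B + 2) / delta * T%:R.
    have -> : 2 * B / s = 2 * B / delta * T%:R.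
      by rewrite /s; field; rewrite !gt_eqF.
    rewrite [leRHS](_ : _ = 2 * B / delta * T%:R + 2 / delta * T%:R);
      last by ring.
    rewrite lerD2l -[leLHS]mulr1; apply: ler_pM => //.
      by rewrite ler_pdivlMr// mul1r.
    by rewrite ler1n (leq_ltn_trans _ TT').
  apply: le_trans (_ : C1%:R ^+ n.+1 * X ^+ n.+1 *
      (4 ^+ n.+1 * ((2 * B + 2) / delta * T%:R)) <= _).
    rewrite ler_wpM2l ?mulr_ge0 ?exprn_ge0 ?powR_ge0//.
    by rewrite ler_wpM2l ?exprn_ge0.
  rewrite le_eqVlt; apply/orP; left; apply/eqP; ring.
Qed.

(** * Proof of the theorem *)

Lemma ln_prod_ord (R : realType) (k : nat) (f : nat -> R) :
  (forall i, (i < k)%N -> 0 < f i) ->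
  ln (\prod_(i < k) f i) = \sum_(i < k) ln (f i).
Proof.
elim: k => [|k IHk] f0; first by rewrite !big_ord0 ln1.
rewrite !big_ord_recr/= lnM ?posrE ?f0//.
  by rewrite IHk// => i ik; apply: f0; exact: ltnW.
by apply: prodr_gt0 => i _; apply: f0; exact: ltnW (ltn_ord i).
Qed.

Lemma ev_Xn (R : realType) (xi : R) (s : nat) : ev xi 'X^s = xi ^+ s.
Proof. by rewrite /ev map_polyXn hornerXn. Qed.

Lemma ev_derivXnM (R : realType) (xi : R) (s : nat) (p : {poly int}) :
  ev xi ('X^s * p)^`() =
  (xi ^+ s.-1 *+ s) * ev xi p + xi ^+ s * ev xi p^`().
Proof.
rewrite derivM derivXn /ev rmorphD !rmorphM/= rmorphMn/= !map_polyXn.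
by rewrite hornerD !hornerM hornerMn !hornerXn.
Qed.

(** This is the determinant estimate for [k = i.+2], applied to the [n + m + 1] shifts selected by
    [shift_family]. *)
Lemma system_ineq (R : realType) (xi w C : R) (n i : nat) :
  0 < w -> 0 < C -> (i < n)%N ->
  (forall p : {poly int}, p != 0 -> (size p <= n.+1)%N ->
    `|ev xi p^`()| <= C * `|ev xi p| * (naive_height p)%:R `^ (w + 1)) ->
  exists2 K2 : R, 0 < K2 & forall T delta v eta,
    (0 < T)%N -> 0 < delta -> good_system xi n T delta v eta ->
    1 <= K2 * (delta ^+ 2 * T%:R ^+ (2 * (n.+1 - i.+2)) *
               (eta i.+1)%:R `^ w * \prod_(l < i.+1) (eta l.+1)%:R).
Proof.
move=> w0 C0 i_n L; set m := (n.+1 - i.+2)%N; pose k := i.+2.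
have mk : (m + k = n.+1)%N by rewrite /m subnK.
pose N := (2 * m + k)%N.
pose La : R := (1 + `|xi|) ^+ m.
have La1 : 1 <= La by rewrite exprn_ege1// lerDl.
have La0 : 0 < La := lt_le_trans ltr01 La1.
have mC0 : 0 < m%:R + C by rewrite ltr_wpDl.
have Xle s : (s <= m)%N -> `|xi| ^+ s <= La.
  move=> sm; apply: le_trans (_ : (1 + `|xi|) ^+ s <= _).
    by rewrite lerXn2r ?nnegrE ?addr_ge0// lerDr.
  by rewrite ler_weXn2l// lerDl.
exists (N`!%:R * (La * La * (m%:R + C) * 3 `^ w * 3 ^+ N)).
  by rewrite !mulr_gt0 ?exprn_gt0 ?powR_gt0// ltr0n fact_gt0.
move=> T delta v eta T0 d0 [[eta0 eta1] mono vP [sv1 cop] iv].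
have TR : 0 < T%:R :> R by rewrite ltr0n.
have sQ (p : {poly int}) : size (polyQ p) = size p.
  by rewrite size_map_inj_poly//; exact: intr_inj.
have [j jk||||s [j [sj iu]]] := @shift_family rat n m k (fun t =>
  polyQ (v t)) mk isT.
- by rewrite sQ; have [] := vP j; rewrite -?mk// (leq_trans jk)// leq_addl.
- by rewrite sQ.
- exact: cop.
- by apply: indepW iv; rewrite -mk leq_addl.
rewrite -/N in sj iu.
pose u t := 'X^(s t) * v (j t).
pose g t : R := 3 * (eta (j t))%:R.
have jn t : (t < N)%N -> (j t < n.+1)%N.
  by move=> /sj[_ jt _]; rewrite -mk (leq_trans jt)// leq_addl.
have etaT t : (t < N)%N -> T%:R <= (eta (j t))%:R :> R.
  by move=> /jn jt; rewrite ler_nat -eta0; apply: mono.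
have etak t : (t < N)%N -> (eta (j t))%:R <= (eta i.+1)%:R :> R.
  move=> tN; have [_ jt _] := sj t tN; rewrite ler_nat; apply: mono.
  by rewrite -ltnS jt.
have T1 : 1 <= T%:R :> R by rewrite ler1n.
have g1 t : (t < N)%N -> 1 <= g t by move=> /etaT; rewrite /g; lra.
(* Every row has [eta (j t) >= T], which permits the division by [T]; it cancels the extra factor
   [T] in [prod_le]. The factor with exponent [w] in [B] comes from the derivative hypothesis. *)
pose A := La * delta / T%:R.
pose B := La * delta * (m%:R + C) * (3 * (eta i.+1)%:R) `^ w.
have det := @det_ev_lower_bound R xi A B N u g.
have {}det : 1 <= N`!%:R * (A * B * \prod_(t < N) g t).
  apply: det.
  - by rewrite /N /k !addnS.
  - apply: eq_indep iu => t _.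
    by rewrite /u /polyQ rmorphM/= map_polyXn.
  - move=> t tN; rewrite (_ : N = n.+1 + m)%N;
      last by rewrite /N -mk addnAC mul2n addnn.
    by apply: size_XnM_leq; [have [] := vP _ (jn t tN)|have [] := sj t tN].
  - move=> t l tN; rewrite /u coefXnM; have [_ vc _] := vP _ (jn t tN).
    by case: ifP => _; [rewrite normr0 (le_trans ler01)// g1|exact: vc].
  - move=> t tN; rewrite /u evM ev_Xn normrM normrX.
    have [_ _ evt] := vP _ (jn t tN); have [st _ _] := sj t tN.
    apply: le_trans (_ : La * delta <= _); first by apply: ler_pM => //;
      exact: Xle.
    rewrite /A -mulrA ler_peMr ?mulr_ge0 ?(ltW La0) ?(ltW d0)//.
    by rewrite mulrC ler_pdivlMr// mul1r /g; have := etaT t tN; lra.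
  - move=> t tN; rewrite /u ev_derivXnM.
    have [svt vc evt] := vP _ (jn t tN); have [st _ _] := sj t tN.
    have gw1 : 1 <= g t `^ w by apply: powR_ge1; [exact: g1|exact: ltW].
    have g0 : 0 < g t := lt_le_trans ltr01 (g1 t tN).
    have d' : `|ev xi (v (j t))^`()| <= C * delta * (g t * g t `^ w).
      have [->|v0] := eqVneq (v (j t)) 0.
        rewrite deriv0 /ev rmorph0 horner0 normr0.
        by rewrite !mulr_ge0 ?(ltW C0) ?(ltW d0) ?(ltW g0)// powR_ge0.
      apply: le_trans (L _ v0 svt) _; apply: ler_pM.
      + by rewrite mulr_ge0// ltW.
      + exact: powR_ge0.
      + by rewrite ler_pM2l.
      + rewrite -[X in X * _]powRr1 ?(ltW g0)// -powRD; last first.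
          by apply/implyP => _; rewrite gt_eqF.
        rewrite addrC; apply: ge0_ler_powR.
        * by rewrite addr_ge0// ltW.
        * by rewrite nnegrE.
        * by rewrite nnegrE ltW.
        * by apply: height_leR => //; exact: ltW.
    apply: le_trans (ler_normD _ _) _; rewrite !normrM normrMn !normrX.
    have e1 : `|xi| ^+ (s t).-1 *+ s t * `|ev xi (v (j t))| <= La * m%:R * delta.
      apply: ler_pM => //.
      rewrite -mulr_natr; apply: ler_pM => //.
        by apply: Xle; exact: leq_trans (leq_pred _) st.
      by rewrite ler_nat.
    have e2 : `|xi| ^+ s t * `|ev xi (v (j t))^`()| <=
        La * (C * delta * (g t * g t `^ w)).
      by apply: ler_pM => //; exact: Xle.
    apply: le_trans (lerD e1 e2) _.
    have gg : 1 <= g t * g t `^ w by rewrite -[leLHS]mulr1; apply: ler_pM =>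
      //; exact: g1.
    apply: le_trans (_ : La * delta * (m%:R + C) * (g t * g t `^ w) <= _).
      rewrite [leRHS](_ : _ = La * m%:R * delta * (g t * g t `^ w) +
        La * (C * delta * (g t * g t `^ w))); last by ring.
      rewrite lerD2r ler_peMr// mulr_ge0 ?(ltW d0)//.
      by rewrite mulr_ge0// ltW.
    rewrite (mulrC (g t)) mulrA /B ler_pM2r// ler_wpM2l//.
      by rewrite !mulr_ge0// ltW.
    apply: ge0_ler_powR; rewrite ?nnegrE ?(ltW w0) ?(ltW g0) ?mulr_ge0//.
    by rewrite /g ler_pM2l//; exact: etak.
(* Rows [t <= 2 * m] have index at most 1 and contribute [T] each; row [2 * m + r] with [r >= 1]
   contributes at most [eta r]. *)
have prod_le : \prod_(t < N) g t <=
    3 ^+ N * (T%:R ^+ (2 * m) * (T%:R * \prod_(l < i.+1) (eta l.+1)%:R)).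
  rewrite /g big_split/= prodr_const card_ord ler_pM2l ?exprn_gt0//.
  apply: le_trans (_ : \prod_(t < N) (eta (maxn 1 (t - 2 * m)))%:R <= _).
    apply: ler_prod => t _; rewrite ler0n ler_nat /=; apply: mono.
    have [_ jt ->] := sj t (ltn_ord t) => /=.
    have := ltn_ord t; rewrite -mk; clear; rewrite /N /k; lia.
  rewrite /N big_split_ord/=; apply: ler_pM.
  - by apply: prodr_ge0.
  - by apply: prodr_ge0.
  - rewrite (eq_bigr (fun=> T%:R)); first by rewrite prodr_const card_ord.
    move=> t _ /=; rewrite (_ : maxn _ _ = 1%N) ?eta1//.
    by have := ltn_ord t; lia.
  - rewrite /k big_ord_recl/= addn0 subnn maxn0 eta1 ler_wpM2l//.
    rewrite le_eqVlt; apply/orP; left; apply/eqP; apply: eq_bigr => l _.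
    by rewrite /bump leq0n add1n addKn (maxn_idPr _).
apply: le_trans det _.
rewrite -[leRHS]mulrA ler_pM2l ?ltr0n ?fact_gt0//.
have AB0 : 0 <= A * B.
  by rewrite /A /B !mulr_ge0 ?invr_ge0 ?powR_ge0 ?(ltW La0) ?(ltW d0) ?(ltW mC0).
apply: le_trans (ler_wpM2l AB0 prod_le) _.
rewrite /A /B powRM//.
rewrite le_eqVlt; apply/orP; left; apply/eqP.
by field; rewrite gt_eqF.
Qed.

(** * Passage to logarithms and comparison with [F_inf] *)

Local Open Scope classical_set_scope.

(** The term [k = 2] equals [2 * x - 2 * n + 1], which is at least 1 for [x >= n]. *)
Lemma F_inf_ge1 (R : realType) (n : nat) : (2 <= n)%N -> (1%:E <= F_inf R n)%E.
Proof.
move=> n2; apply: le_ereal_inf_tmp => _ [x nx <-].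
apply: le_ereal_inf_tmp => _ [a aA <-].
have i0 : (0 < n)%N by exact: ltnW.
apply: le_trans (_ : ((A_ x a (Ordinal i0) / a 0 (Ordinal i0))%:E <= _)%E);
  last first.
  exact: (le_bigmax -oo%E (fun i => (A_ x a i / a 0 i)%:E)).
rewrite lee_fin; have [a0 _ _] := aA; rewrite a0// divr1 /A_.
rewrite (big_pred1 (Ordinal i0)) => [|j]; last by rewrite /= leqn0.
rewrite a0// subSS natrB; last exact: ltnW.
have -> : (Ordinal i0).+1%:R = 1 :> R by [].
by move: nx => /=; clear; lra.
Qed.

Lemma F_inf_le (R : realType) (xi w e : R) (n : nat) : (2 <= n)%N ->
  ~ algebraicOver (ratr : rat -> R) xi -> 0 < w -> 0 < e ->
  finite_set (approximants n xi w) -> (F_inf R n <= (w + e)%:E)%E.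
Proof.
move=> n2 xiT w0 e0 fin.
have [C C0 L] := ev_deriv_le w0 xiT fin.
have n1R : 0 < n.+1%:R :> R by rewrite ltr0n.
pose th : R := Num.min 1 (e / (4 * n.+1%:R)).
have th0 : 0 < th by rewrite lt_min ltr01 divr_gt0// mulr_gt0.
have th01 : 0 < th <= 1 by rewrite th0 ge_min lexx.
have the : 2 * n.+1%:R * th <= e / 2.
  have : th <= e / (4 * n.+1%:R) by rewrite ge_min lexx orbT.
  by rewrite ler_pdivlMr ?mulr_gt0//; lra.
have [K1 K10 sys] := good_system_exists n2 w0 C0 th01 xiT L.
have /fin_all_exists2[K2 K20 HK2] := fun i : 'I_n =>
  system_ineq w0 C0 (ltn_ord i) L.
(* Taking [ln T] at least [Z] absorbs the constants [K1] and all [K2 i] into [e / 2]; the other half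
   of [e] is reserved for the loss from [th]. *)
pose Z : R := 1 + \sum_(i < n) `|2 / e * (2 * ln K1 + ln (K2 i))|.
have [T [delta [v [eta [[T0T T1] d0 gs prod_eta]]]]] := sys (expR Z).
have T_gt0 : (0 < T)%N by exact: ltnW.
have TR : 0 < T%:R :> R by rewrite ltr0n.
have [[eta0 eta1] mono _ _ _] := gs.
have Teta j : (j < n.+1)%N -> (T <= eta j)%N.
  by move=> jn; rewrite -eta0; apply: mono.
have etaR j : (j < n.+1)%N -> 0 < (eta j)%:R :> R.
  by move=> jn; rewrite ltr0n (leq_trans T_gt0) ?Teta.
pose tau : R := ln T%:R.
have Ztau : Z <= tau by rewrite -[Z]expRK ler_ln ?posrE ?expR_gt0.
have Z0 : 0 < Z by rewrite ltr_pwDl// sumr_ge0.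
have tau0 : 0 < tau := lt_le_trans Z0 Ztau.
pose l (j : nat) : R := ln (eta j)%:R.
have lmono i j : (i <= j < n.+1)%N -> l i <= l j.
  move=> ij; rewrite /l ler_ln ?posrE ?ler_nat ?mono//; apply: etaR.
    by have /andP[] := ij; exact: leq_ltn_trans.
  by have /andP[] := ij.
(* The entries are logarithms to base [T], and [x] is then defined as their sum, so that [a] belongs
   to [calA x]. *)
pose a : 'rV[R]_n := \row_(i < n) (l i.+1 / tau).
have a1 i : 1 <= a 0 i.
  rewrite mxE ler_pdivlMr// mul1r /tau -eta1; apply: lmono.
  by rewrite !ltnS leq0n ltn_ord.
have aA : calA (\sum_(i < n) a 0 i) a.
  split => // [i i0|i j ij].
    by rewrite mxE i0 /l eta1 divff// gt_eqF.
  by rewrite !mxE ler_pM2r ?invr_gt0// lmono// !ltnS ij/=.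
set x := \sum_(i < n) a 0 i in aA.
apply: le_trans (_ : (F_vec x a <= _)%E).
  apply: (@le_trans _ _ (F_at n x)).
    apply: ereal_inf_lbound; exists x => //=.
    rewrite /x -[n%:R](_ : \sum_(i < n) 1 = _);
      last by rewrite sumr_const card_ord.
    exact: ler_sum.
  by apply: ereal_inf_lbound; exists a.
apply: bigmax_le => [|i _]; rewrite ?leNye// lee_fin.
rewrite ler_pdivrMr ?(lt_le_trans ltr01)//.
set m := (n.+1 - i.+2)%N.
have xE : x = (\sum_(j < n) l j.+1) / tau.
  by rewrite mulr_suml; apply: eq_bigr => j _; rewrite mxE.
have sE : \sum_(j < n | (j <= i)%N) a 0 j = (\sum_(j < i.+1) l j.+1) / tau.
  rewrite mulr_suml (big_ord_widen n (fun j => l j.+1 / tau))//.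
  by apply: eq_big => // j _; rewrite mxE.
have h1 : \sum_(j < n) l j.+1 <= ln K1 + n.+1%:R * (th * tau) - ln delta.
  rewrite -(@ln_prod_ord R n (fun j => (eta j.+1)%:R)) => [|j jn];
    last exact: etaR.
  have Tth : 0 < T%:R `^ th by rewrite powR_gt0.
  rewrite mulr_natl -ln_powR -lnXn// -lnM ?posrE ?exprn_gt0//.
  rewrite -ln_div ?posrE ?mulr_gt0 ?exprn_gt0// ler_ln ?posrE//.
    by apply: prodr_gt0 => j _; apply: etaR; rewrite ltnS.
  by rewrite divr_gt0// mulr_gt0// exprn_gt0.
have h2 : 0 <= ln (K2 i) + (2 * ln delta + 2 * m%:R * tau + w * l i.+1 +
    \sum_(j < i.+1) l j.+1).
  have etai : 0 < (eta i.+1)%:R `^ w :> R by rewrite powR_gt0// etaR// ltnS.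
  have jn (j : nat) : (j < i.+1)%N -> (j.+1 < n.+1)%N.
    by move=> ji; rewrite ltnS (leq_trans ji).
  have pe : 0 < \prod_(j < i.+1) (eta j.+1)%:R :> R.
    by apply: prodr_gt0 => j _; apply: etaR; exact: jn.
  have := HK2 i T delta v eta T_gt0 d0 gs.
  rewrite -ler_ln ?posrE ?mulr_gt0 ?exprn_gt0// ln1.
  rewrite !lnM ?posrE ?mulr_gt0 ?exprn_gt0// !lnXn// ln_powR.
  rewrite (@ln_prod_ord R i.+1 (fun j => (eta j.+1)%:R)) => [|j /jn];
    last exact: etaR.
  by rewrite -!(mulr_natl (ln _)) natrM -/tau -/m (mulr_natl (ln delta) 2) mulr2n.
have h3 : 2 * ln K1 + ln (K2 i) <= e / 2 * tau.
  have : 2 / e * (2 * ln K1 + ln (K2 i)) <= tau.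
    apply: le_trans Ztau; apply: le_trans (ler_norm _) _.
    rewrite /Z (bigD1 i)//= addrCA lerDl addr_ge0// sumr_ge0//.
  rewrite mulrAC ler_pdivrMr//; lra.
rewrite /A_ sE xE -/m; have -> : a 0 i = l i.+1 / tau by rewrite mxE.
(* Adding twice [h1] to [h2] eliminates [ln delta]; the remaining error is at most [e * tau], hence
   at most [e * l i.+1]. *)
rewrite -(ler_pM2r tau0).
rewrite [leLHS](_ : _ = 2 * (\sum_(j < n) l j.+1) - 2 * m%:R * tau -
  \sum_(j < i.+1) l j.+1); last by field; rewrite gt_eqF.
rewrite [leRHS](_ : _ = (w + e) * l i.+1); last by field; rewrite gt_eqF.
have h4 : tau <= l i.+1.
  by rewrite /tau -eta1; apply: lmono; rewrite !ltnS leq0n ltn_ord.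
have h5 : e * tau <= e * l i.+1 by rewrite ler_pM2l.
have h6 : 2 * n.+1%:R * th * tau <= e / 2 * tau by rewrite ler_pM2r.
move: h1 h2 h3 h5 h6; rewrite !mulrA mulrDl.
move: (\sum_(j < n) _) (\sum_(j < i.+1) _) => S1 S2; lra.
Qed.

Theorem theorem6p1 (R : realType) (xi : R) (n : nat) (n_ge2 : (2 <= n)%N)
    (xi_transcendental : ~ algebraicOver (ratr : rat -> R) xi) :
  (omega_star n xi >= F_inf R n)%E.
Proof.
rewrite leNgt; apply/negP => lt1.
have F1 := @F_inf_ge1 R n n_ge2.
(* A supremum that is negative or [-oo] is replaced by 0, which is still below [F_inf R n] by
   [F_inf_ge1]. *)
have [m [m0 om mF]] : exists m : R, [/\ 0 <= m, (omega_star n xi <= m%:E)%E &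
    (m%:E < F_inf R n)%E].
  case: (omega_star n xi) lt1 => [r| |] lt1.
  - exists (Num.max r 0); rewrite le_max lexx orbT; split => //.
      by rewrite lee_fin le_max lexx.
    rewrite EFin_max gt_max lt1/=; apply: lt_le_trans F1.
    by rewrite lte_fin.
  - by move: lt1; rewrite ltNge leey.
  - exists 0; split; [exact: lexx|exact: leNye|].
    by apply: lt_le_trans F1; rewrite lte_fin.
have [f mf fF] : exists2 f : R, m < f & (f%:E <= F_inf R n)%E.
  case: (F_inf R n) mF => [r| |]; last by [].
  - by rewrite lte_fin => mr; exists r.
  - by move=> _; exists (m + 1); [rewrite ltrDl|rewrite leey].
(* Both the threshold [m + e] and the bound [m + 2 * e] from [F_inf_le] then stay below [f]. *)
pose e := (f - m) / 3.
have e0 : 0 < e by rewrite divr_gt0// subr_gt0.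
have w0 : 0 < m + e by rewrite ltr_wpDl.
have fin : finite_set (approximants n xi (m + e)).
  apply: contrapT => inf.
  have : ((m + e)%:E <= omega_star n xi)%E.
    by apply: ereal_sup_ubound; exists (m + e).
  by move=> /le_trans/(_ om); rewrite lee_fin leNgt ltrDl e0.
have := F_inf_le n_ge2 xi_transcendental w0 e0 fin.
move=> /(le_trans fF); rewrite lee_fin; apply/negP; rewrite -ltNge /e; lra.
Qed.
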